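(* Let $x,y$ be Hermitian $n\times n$ complex matrices, let $t_0>0$, and let $u(t)=e^{itx}e^{iy}$. Suppose that $\|u(t)-1\|<\sqrt{2}$ for all $t\in[0,t_0]$. Let $e^{i\theta_k(t)}$, $k=1,\dots,n$, be the eigenvalues of $u(t)$, with $\theta_1(t)\ge\theta_2(t)\ge\dots\ge\theta_n(t)$ the eigenvalues of $-i\log(u(t))$, and let $\sigma_1(t)\ge\sigma_2(t)\ge\dots\ge\sigma_n(t)\ge 0$ be the singular values of $-i\log(u(t))$. Then for every $1\le m\le n$: (1) the function $t\mapsto\sum_{i=1}^m\theta_i(t)$ is convex in $[0,t_0]$; (2) the function $t\mapsto\sum_{i=m}^n\theta_i(t)$ is concave in $[0,t_0]$; (3) the function $t\mapsto\sum_{i=1}^m\sigma_i(t)$ is convex in $[0,t_0]$.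
   Context: $\|\cdot\|$ denotes the spectral (operator) norm on $M_n(\mathbb C)$. For a unitary matrix $u$ with $\|u-1\|<2$, $\log(u)$ is the principal branch of the logarithm, so $-i\log(u)$ is the unique Hermitian matrix $z$ with $e^{iz}=u$ and $\|z\|<\pi$. Eigenvalues and singular values are repeated according to multiplicity; the singular values of a matrix $a$ are the eigenvalues of $|a|=\sqrt{a^*a}$. *)

(* Defs.v *)
From HB Require Import structures.
From mathcomp Require Import all_boot all_order all_algebra.
From mathcomp Require Import all_classical all_reals all_analysis.
From mathcomp Require Export complex.

Set Implicit Arguments.
Unset Strict Implicit.
Unset Printing Implicit Defensive.

Import Order.TTheory GRing.Theory Num.Theory.
Import numFieldNormedType.Exports.

Local Open Scope classical_set_scope.
Local Open Scope ring_scope.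
Local Open Scope sesquilinear_scope.
Local Open Scope convex_scope.

(* Gives R[i], and hence complex matrices, the topology of the modulus. *)
HB.instance Definition _ (R : rcfType) := NormedModule.copy R[i] R[i]^o.

Section ComplexMatrices.
Variables (R : realType) (n : nat).
Implicit Types (A B u : 'M[R[i]]_n).

Definition l2norm (v : 'cV[R[i]]_n) : R :=
  Num.sqrt (\sum_(i < n) Normc.normc (v i 0) ^+ 2).

(* The norm already carried by 'M[_]_n in the library is the largest modulus of
   an entry, not the operator norm. *)
Definition opnorm A : R :=
  sup [set l2norm (A *m v) | v in [set v : 'cV[R[i]]_n | l2norm v <= 1]].

(* The limit is entrywise, and all norms on 'M[_]_n are equivalent. *)
Definition expmx A : 'M[R[i]]_n :=
  limn (series (fun k : nat => (k`!%:R : R[i])^-1 *: A ^+ k)).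

(* Principal logarithm of a unitary u with opnorm (u - 1%:M) < 2: the unique L
   satisfying the three conditions below (0 if there is no such L). *)
Definition logmx u : 'M[R[i]]_n :=
  xget 0 [set L : 'M[R[i]]_n | [/\ - 'i *: L \is hermsymmx, expmx L = u
                                & opnorm (- 'i *: L) < pi]].

(* The order of R[i] makes 0 <= z mean that z is real and nonnegative. *)
Definition psdmx A : Prop :=
  A \is hermsymmx /\ forall v : 'cV[R[i]]_n, 0 <= (v ^t* *m A *m v) 0 0.

(* Meaningful for positive semidefinite A, which have exactly one positive
   semidefinite square root. *)
Definition sqrtmx A : 'M[R[i]]_n :=
  xget 0 [set B : 'M[R[i]]_n | psdmx B /\ B *m B = A].

Definition absmx A : 'M[R[i]]_n := sqrtmx (A ^t* *m A).

(* With algebraic multiplicity, in an unspecified order: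
   char_poly A = \prod_(a <- eigvals A) ('X - a%:P). *)
Definition eigvals A : seq R[i] :=
  sval (closed_field_poly_normal (char_poly A)).

(* For Hermitian A, whose eigenvalues are real: the k-th largest eigenvalue,
   with k counted from 1. *)
Definition eig A (k : nat) : R :=
  (sort (fun a b : R => b <= a)
        [seq complex.Re a | a <- eigvals A])`_(k.-1).

Definition singval A (k : nat) : R := eig (absmx A) k.

End ComplexMatrices.

(* The reverse inequality in the library's [convex_function]. *)
Definition concave_function (R : numFieldType) (E : lmodType R)
    (E' := convex_lmodType E) (D : set E') (f : E' -> R^o) :=
  forall (t : {i01 R}),
    {in D &, forall (x y : E'), (f x <| t |> f y <= f (x <| t |> y))%R}.

(* Main.v *)
(** Write u(t) = W* diag(e^{i s_j}) W with all |s_j| < pi/2 and s decreasing.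
    The Hermitian matrix K = W* diag(a) W with a_j = tan(s_j/2 + pi/4) is the
    Cayley transform of i u(t), and it is positive definite. Multiplying u(t) by
    e^{ihx}, the Cayley transform of the small matrix T = tan(hx/2), replaces K by
      L = K + (1 - iK) T (1 - KT)^-1 (1 + iK),
    the addition formula of the tangent. Compress to the span V of the first m
    eigenvectors of u(t): since K is positive on the complement of V, dropping
    that part of K decreases V*LV, for h small. What remains is the transform of
    the m x m matrices V*KV and V*TV, whose eigenphases add up to those of V*KV
    plus those of V*TV, by multiplicativity of the determinant. With the
    Courant-Fischer inequalities, the sum F of the m largest phases satisfies
    F(t + h) >= F(t) + g(h) with g odd, hence 2 F(t) <= F(t + h) + F(t - h) for h
    small. As F is continuous, it is convex. Passing to u(t)* gives the concavity
    of the sums of the smallest phases, and the sum of the m largest |s_j| is the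
    maximum over k + l = m of the sum of the k largest minus that of the l
    smallest phases. *)

Require Import Defs.
From HB Require Import structures.
From mathcomp Require Import all_boot all_order all_algebra.
From mathcomp Require Import all_classical all_reals all_analysis.
From mathcomp Require Import perm zify ring lra.
Import Order.TTheory GRing.Theory Num.Theory.
Import numFieldNormedType.Exports.

Local Open Scope classical_set_scope.
Local Open Scope ring_scope.
Local Open Scope sesquilinear_scope.

Set Implicit Arguments.
Unset Strict Implicit.
Unset Printing Implicit Defensive.

(** Ordered eigenvalues need not be differentiable where they cross, which is why only midpoint
    inequalities are proved, with a radius that may depend on [t]. The bound sqrt 2 says that cos
    s_j > 0; the factor i adds pi/2 to each phase, so that the half angles fall in ]0, pi/2[ and all
    tangents are positive. This positivity acts through the resolvent: replacing K by K + D with D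
    >= 0 in (1 - TK)^-1 T adds S D S + S D R0 D S, where S and R0 are the old and the new
    resolvents. For T small the first term dominates, so the gain is nonnegative whatever the sign
    of T, and the lower bound holds for h and for -h alike. There g(h) is twice the sum of the
    arctangents of the eigenvalues of the compressed T, odd because T changes sign with h.
    Determinants add phases only modulo 2 pi; the smallness of T removes the ambiguity. *)

Section QuadraticForms.
Variable R : realType.
Local Notation C := R[i].

(** * Adjoints, diagonal matrices and conjugation by unitaries *)

Lemma adjM m n p (A : 'M[C]_(m, n)) (B : 'M[C]_(n, p)) :
  (A *m B) ^t* = B ^t* *m A ^t*.
Proof. by rewrite trmx_mul map_mxM. Qed.

Lemma adjD m n (A B : 'M[C]_(m, n)) : (A + B) ^t* = A ^t* + B ^t*.
Proof. by apply/matrixP => i j; rewrite !mxE rmorphD. Qed.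

Lemma adjN m n (A : 'M[C]_(m, n)) : (- A) ^t* = - A ^t*.
Proof. by apply/matrixP => i j; rewrite !mxE rmorphN. Qed.

Lemma adjZ m n (c : C) (A : 'M[C]_(m, n)) : (c *: A) ^t* = c^* *: A ^t*.
Proof. by apply/matrixP => i j; rewrite !mxE rmorphM. Qed.

Lemma adj1 n : (1%:M : 'M[C]_n) ^t* = 1%:M.
Proof.
by apply/matrixP => i j; rewrite !mxE eq_sym; case: eqP => _;
  rewrite ?conjC1 ?conjC0.
Qed.

Lemma conj_real (x : R) : ((x%:C)%C : C)^* = (x%:C)%C.
Proof. by rewrite /Num.conj /= /conjc /= oppr0. Qed.

Lemma hermsymmxP n (A : 'M[C]_n) : reflect (A ^t* = A) (A \is hermsymmx).
Proof. by apply: (iffP (is_hermitianmxP _ _ _)); rewrite expr0 scale1r => /esym. Qed.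

Lemma unitarymx_adjK n (W : 'M[C]_n) : W \is unitarymx -> W ^t* *m W = 1%:M.
Proof. by move=> /unitarymxP /mulmx1C. Qed.

Lemma unitarymx1 n : (1%:M : 'M[C]_n) \is unitarymx.
Proof. by apply/unitarymxP; rewrite adj1 mulmx1. Qed.

(** The entries are indexed by [nat], so that one sequence serves both an n x n matrix and its
    compression to the first m coordinates. *)
Definition cdiag n (d : nat -> C) : 'M[C]_n := diag_mx (\row_(j < n) d j).
Definition rdiag n (d : nat -> R) : 'M[C]_n := cdiag n (fun j => ((d j)%:C)%C).

Lemma cdiagM n (d e : nat -> C) : cdiag n d *m cdiag n e = cdiag n (fun j => d j * e j).
Proof. by rewrite mulmx_diag; congr diag_mx; apply/rowP => j; rewrite !mxE. Qed.

Lemma cdiagD n (d e : nat -> C) : cdiag n d + cdiag n e = cdiag n (fun j => d j + e j).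
Proof. by rewrite -raddfD; congr diag_mx; apply/rowP => j; rewrite !mxE. Qed.

Lemma cdiagZ n (c : C) (d : nat -> C) : c *: cdiag n d = cdiag n (fun j => c * d j).
Proof. by rewrite -linearZ; congr diag_mx; apply/rowP => j; rewrite !mxE. Qed.

Lemma cdiag_cst n (c : C) : cdiag n (fun=> c) = c%:M.
Proof. by rewrite -diag_const_mx; congr diag_mx; apply/rowP => j; rewrite !mxE. Qed.

Lemma adj_cdiag n (d : nat -> C) : (cdiag n d) ^t* = cdiag n (fun j => (d j)^*).
Proof. by rewrite tr_diag_mx map_diag_mx; congr diag_mx; apply/rowP => j; rewrite !mxE. Qed.

Lemma eq_cdiag n (d e : nat -> C) : (forall j, (j < n)%N -> d j = e j) ->
  cdiag n d = cdiag n e.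
Proof. by move=> de; congr diag_mx; apply/rowP => j; rewrite !mxE de. Qed.

Lemma adj_rdiag n (d : nat -> R) : (rdiag n d) ^t* = rdiag n d.
Proof. by rewrite adj_cdiag; apply: eq_cdiag => j _; rewrite conj_real. Qed.

Lemma det_cdiag n (d : nat -> C) : \det (cdiag n d) = \prod_(j < n) d j.
Proof. by rewrite det_diag; apply: eq_bigr => j _; rewrite !mxE. Qed.

(** For [A] diagonal and [W] unitary, the eigenvectors are the columns of [W ^t*]. *)
Definition conjU n (W A : 'M[C]_n) : 'M[C]_n := W ^t* *m A *m W.

Lemma conjUM n (W A B : 'M[C]_n) : W \is unitarymx ->
  conjU W A *m conjU W B = conjU W (A *m B).
Proof.
by move=> Wu; rewrite /conjU !mulmxA mulmxtVK.
Qed.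

Lemma conjUD n (W A B : 'M[C]_n) : conjU W (A + B) = conjU W A + conjU W B.
Proof. by rewrite /conjU mulmxDr mulmxDl. Qed.

Lemma conjUN n (W A : 'M[C]_n) : conjU W (- A) = - conjU W A.
Proof. by rewrite /conjU mulmxN mulNmx. Qed.

Lemma conjUZ n (W A : 'M[C]_n) (c : C) : conjU W (c *: A) = c *: conjU W A.
Proof. by rewrite /conjU -scalemxAr -scalemxAl. Qed.

Lemma conjU1 n (W : 'M[C]_n) : W \is unitarymx -> conjU W 1%:M = 1%:M.
Proof. by move=> Wu; rewrite /conjU mulmx1 unitarymx_adjK. Qed.

Lemma conjUs n (W : 'M[C]_n) c : W \is unitarymx -> conjU W c%:M = c%:M.
Proof. by move=> Wu; rewrite -scalemx1 conjUZ conjU1. Qed.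

Lemma adj_conjU n (W A : 'M[C]_n) : (conjU W A) ^t* = conjU W (A ^t*).
Proof. by rewrite /conjU !adjM trmxCK mulmxA. Qed.

Lemma conjU_comp n (W X A : 'M[C]_n) : conjU W (conjU X A) = conjU (X *m W) A.
Proof. by rewrite /conjU adjM !mulmxA. Qed.

Lemma conjUK n (W A : 'M[C]_n) : W \is unitarymx -> conjU (W ^t*) (conjU W A) = A.
Proof.
move=> Wu; rewrite conjU_comp (unitarymxP _) // /conjU adj1 mul1mx mulmx1 //.
Qed.

Lemma det_conjU n (W A : 'M[C]_n) : W \is unitarymx -> \det (conjU W A) = \det A.
Proof.
move=> Wu; rewrite /conjU !det_mulmx mulrC mulrA -det_mulmx.
by rewrite (unitarymxP _) // det1 mul1r.
Qed.

Lemma adj_unitarymx n (W : 'M[C]_n) : W \is unitarymx -> W ^t* \is unitarymx.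
Proof. by rewrite trmxC_unitary. Qed.

(** * Quadratic forms, Courant-Fischer and sorted diagonalization *)

Definition qform n (A : 'M[C]_n) (v : 'cV[C]_n) : C := (v ^t* *m A *m v) 0 0.

Lemma qformD n (A B : 'M[C]_n) v : qform (A + B) v = qform A v + qform B v.
Proof. by rewrite /qform mulmxDr mulmxDl mxE. Qed.

Lemma qformN n (A : 'M[C]_n) v : qform (- A) v = - qform A v.
Proof. by rewrite /qform mulmxN mulNmx mxE. Qed.

Lemma qformZ n (c : C) (A : 'M[C]_n) v : qform (c *: A) v = c * qform A v.
Proof. by rewrite /qform -scalemxAr -scalemxAl mxE. Qed.

Lemma qform_conj m n (A : 'M[C]_n) (B : 'M[C]_(n, m)) v :
  qform (B ^t* *m A *m B) v = qform A (B *m v).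
Proof. by rewrite /qform adjM !mulmxA. Qed.

Lemma qform_cdiag n (d : nat -> C) v :
  qform (cdiag n d) v = \sum_(i < n) d i * `|v i 0| ^+ 2.
Proof.
rewrite /qform mxE; apply: eq_bigr => i _.
by rewrite mul_mx_diag !mxE normCK; ring.
Qed.

Lemma qform1 n v : qform (1%:M : 'M[C]_n) v = \sum_(i < n) `|v i 0| ^+ 2.
Proof.
rewrite -cdiag_cst qform_cdiag; apply: eq_bigr => i _; by rewrite mul1r.
Qed.

Lemma qform1_ge0 n v : 0 <= qform (1%:M : 'M[C]_n) v.
Proof. by rewrite qform1 sumr_ge0 // => i _; rewrite exprn_ge0. Qed.

Lemma qform1_gt0 n v : v != 0 -> 0 < qform (1%:M : 'M[C]_n) v.
Proof.
move=> v0; rewrite lt_neqAle qform1_ge0 andbT eq_sym; apply: contra v0.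
rewrite qform1 psumr_eq0 => [/allP v0|i _]; last by rewrite exprn_ge0.
apply/eqP/colP => i; rewrite mxE; have /implyP := v0 i (mem_index_enum i).
by rewrite sqrf_eq0 normr_eq0 => /(_ isT)/eqP.
Qed.

Lemma qform1_isometry m n (V : 'M[C]_(n, m)) v : V ^t* *m V = 1%:M ->
  qform 1%:M (V *m v) = qform 1%:M v.
Proof. by move=> VV; rewrite -qform_conj mulmx1 VV. Qed.

Definition nonincr n (d : nat -> R) :=
  forall i j, (i <= j)%N -> (j < n)%N -> d j <= d i.

(* Courant-Fischer: a dimension count gives w <> 0 that is supported on the
   first i.+1 eigenvectors of the small matrix and whose image under V avoids
   the first i eigenvectors of the large one. *)
Lemma eigenvalue_compression m n (a b : nat -> R) (W : 'M[C]_n) (X : 'M[C]_m)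
    (V : 'M[C]_(n, m)) : (m <= n)%N ->
  W \is unitarymx -> X \is unitarymx -> V ^t* *m V = 1%:M ->
  nonincr n a -> nonincr m b ->
  (forall v, qform (conjU X (rdiag m b)) v <= qform (conjU W (rdiag n a)) (V *m v)) ->
  forall i, (i < m)%N -> b i <= a i.
Proof.
move=> lemn Wu Xu VV sa sb le_form i lim.
(* Row [i] vanishes, hence [M] is singular; the other rows are the m - 1 linear conditions imposed
   on [w]. *)
pose M : 'M[C]_m := \matrix_(k, l) if (k < i)%N then (W *m V) (widen_ord lemn k) l
  else if k == i :> nat then 0 else X k l.
have [w w0 Mw] : exists2 w : 'cV[C]_m, w != 0 & M *m w = 0.
  have : \det M == 0.
    apply/eqP; rewrite (expand_det_row _ (Ordinal lim)) big1 // => j _.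
    by rewrite mxE ltnn eqxx mul0r.
  rewrite -det_tr => /det0P[v v0 vM]; exists v^T.
    by apply: contra v0 => /eqP v0; rewrite -[v]trmxK v0 trmx0.
  by rewrite -[M]trmxK -trmx_mul vM trmx0.
have Xw (k : 'I_m) : (i < k)%N -> (X *m w) k 0 = 0.
  move=> ltik; have /colP/(_ k) := Mw; rewrite !mxE => Mk; rewrite -[RHS]Mk.
  apply: eq_bigr => l _.
  by rewrite !mxE ltnNge (ltnW ltik) /= gtn_eqF.
have WVw (k : 'I_n) : (k < i)%N -> (W *m (V *m w)) k 0 = 0.
  move=> ltki; have lkm : (k < m)%N := ltn_trans ltki lim.
  have /colP/(_ (Ordinal lkm)) := Mw; rewrite mulmxA !mxE => Mk; rewrite -[RHS]Mk.
  apply: eq_bigr => l _; rewrite ?mxE /= ltki; congr (_ * _).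
  by rewrite ?mxE; apply: eq_bigr => p _; congr (W _ _ * _); apply: val_inj.
have := le_form w; rewrite !qform_conj !qform_cdiag => le_w.
have low : (b i)%:C%C * qform 1%:M w <= \sum_(k < m) (b k)%:C%C * `|(X *m w) k 0| ^+ 2.
  rewrite -(qform1_isometry w (unitarymx_adjK Xu)) qform1 mulr_sumr.
  apply: ler_sum => k _; have [leki|ltik] := leqP k i.
    by rewrite ler_wpM2r ?exprn_ge0 // lecR sb.
  by rewrite Xw // normr0 expr0n !mulr0.
have upp : \sum_(k < n) (a k)%:C%C * `|(W *m (V *m w)) k 0| ^+ 2
    <= (a i)%:C%C * qform 1%:M w.
  rewrite -(qform1_isometry w VV) -(qform1_isometry (V *m w) (unitarymx_adjK Wu)).
  rewrite qform1 mulr_sumr.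
  apply: ler_sum => k _; have [leik|ltki] := leqP i k.
    by rewrite ler_wpM2r ?exprn_ge0 // lecR sa.
  by rewrite WVw // normr0 expr0n !mulr0.
have := le_trans (le_trans low le_w) upp.
by rewrite ler_pM2r ?qform1_gt0 // lecR.
Qed.

(** The eigenvalues of the spectral theorem are sorted, and the sorting permutation acts on the rows
    of the unitary. *)
Lemma hermitian_diagonalization n (A : 'M[C]_n) : A ^t* = A ->
  exists W d, [/\ W \is unitarymx, nonincr n d & A = conjU W (rdiag n d)].
Proof.
move=> /hermsymmxP Ah; have := hermitian_normalmx Ah => /orthomx_spectralP.
set P := spectralmx A; set D := spectral_diag A => defA.
have Pu : P \is unitarymx by apply: spectral_unitarymx.
rewrite invmx_unitary // in defA.
have Dr j : D 0 j = ((complex.Re (D 0 j))%:C)%C.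
  by rewrite RRe_real //; apply/mxOverP/hermitian_spectral_diag_real.
pose t := [tuple complex.Re (D 0 j) | j < n].
pose s := sort (fun x y : R => y <= x) t.
have szs : size s == n by rewrite size_sort size_tuple.
have /tuple_permP[p tp] : perm_eq (Tuple szs) t by rewrite /= perm_sort.
exists (row_perm p P), (nth 0 s); split.
- rewrite row_permE; apply: mul_unitarymx Pu; apply/unitarymxP/matrixP => j k.
  rewrite /perm_mx !mxE (bigD1 (p j)) //= !mxE eqxx big1 ?addr0; last first.
    by move=> l lp; rewrite !mxE eq_sym (negbTE lp) mul0r.
  by rewrite mul1r (inj_eq perm_inj) eq_sym; case: eqP => _; rewrite ?conjC1 ?conjC0.
- move=> j k jk kn; have ss : sorted (fun x y : R => y <= x) s.
    by apply: sort_sorted => x y; apply: le_total.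
  apply: (sorted_leq_nth (leT := fun x y : R => y <= x)) => //.
  + by move=> x y z yx zy; apply: le_trans zy yx.
  + by rewrite inE (eqP szs) (leq_ltn_trans jk).
  + by rewrite inE (eqP szs).
rewrite {1}defA /conjU; apply/matrixP => j k; rewrite !mul_mx_diag !mxE.
rewrite (reindex_inj (@perm_inj _ p)) /=; apply: eq_bigr => l _.
rewrite !mxE; congr (_ * _ * _).
rewrite Dr; congr ((_)%:C)%C; have := tnth_mktuple (fun i => tnth t (p i)) l.
rewrite (tnth_nth 0) -tp /= => ->; by rewrite tnth_mktuple.
Qed.

End QuadraticForms.

(** * The tangent addition formula in a noncommutative ring *)

Section CayleyAlgebra.
Variable A : pzRingType.
Implicit Types k t r e d l q j : A.

(* With k = 'i K and r = 'i R, the element k + (1 - k) r (1 + k) is 'i times the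
   addition formula tan (x + y) = tan x + (1 + tan^2 x) tan y / (1 - tan x tan y). *)
Definition cayley_add k r := k + (1 - k) * r * (1 + k).

(** In [1 - cayley_add k r] and [1 + cayley_add k r] a factor in [k] alone splits off; the remaining
    factor becomes [1 - t] or [1 + t] after multiplication by [1 + t k] or [1 + k t]. *)
Lemma one_sub_cayley_add k r :
  1 - cayley_add k r = (1 - k) * (1 - r * (1 + k)).
Proof. by rewrite /cayley_add mulrBr mulr1 mulrA opprD addrA. Qed.

Lemma one_add_cayley_add k r :
  1 + cayley_add k r = (1 + (1 - k) * r) * (1 + k).
Proof. by rewrite /cayley_add [RHS]mulrDl mul1r addrA. Qed.

(** Here [r] stands for [t (1 + k t)^-1 = (1 + t k)^-1 t], given by its defining equations. *)
Lemma resolvent_left k t r : r * (1 + k * t) = t ->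
  (1 + (1 - k) * r) * (1 + k * t) = 1 + t.
Proof.
move=> rq; by rewrite mulrDl mul1r -mulrA rq mulrBl mul1r addrACA subrr addr0.
Qed.

Lemma resolvent_right k t r : (1 + t * k) * r = t ->
  (1 + t * k) * (1 - r * (1 + k)) = 1 - t.
Proof.
move=> pr; rewrite mulrBr mulr1 mulrA pr mulrDr mulr1 opprD addrACA.
by rewrite subrr addr0.
Qed.

(** [e] and [d] are the Cayley transforms of [t] and [k], which need not commute; [j] and [q] are
    the inverses of [1 - t] and [1 + k t]. The product [e d] is the transform of
    [cayley_add k r]. *)
Lemma cayley_mul k t r e d q j :
  (1 - t) * j = 1 -> j * (1 - t) = 1 -> q * (1 + k * t) = 1 ->
  (1 + k * t) * q = 1 ->
  (1 + t * k) * r = t -> r * (1 + k * t) = t ->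
  e * (1 - t) = 1 + t -> d * (1 - k) = 1 + k ->
  e * d * (1 - cayley_add k r) = 1 + cayley_add k r.
Proof.
move=> tj jt qk kq pr rq et dk.
rewrite one_sub_cayley_add one_add_cayley_add -mulrA (mulrA d) dk.
have pz := resolvent_right pr; have yq := resolvent_left rq.
(* Both sides equal [(1 + k) j (1 + k) - k (1 + k)]. *)
have star : (1 + k) * j * (1 + t * k) = (1 + k * t) * j * (1 + k).
  have -> : 1 + t * k = (1 + k) - (1 - t) * k.
    by rewrite mulrBl mul1r opprB addrACA subrr addr0.
  have -> : 1 + k * t = (1 + k) - k * (1 - t).
    by rewrite mulrBr mulr1 opprB addrACA subrr addr0.
  have e1 : (1 + k) * j * ((1 - t) * k) = (1 + k) * k.
    by rewrite -mulrA (mulrA j) jt mul1r.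
  have e2 : k * (1 - t) * j * (1 + k) = k * (1 + k).
    by rewrite -(mulrA k) tj mulr1.
  rewrite mulrBr e1 [in RHS]mulrBl [in RHS]mulrBl e2; congr (_ - _).
  by rewrite mulrDr mulrDl mulr1 mul1r.
have key : (1 + k) * (1 - r * (1 + k)) = (1 - t) * (q * (1 + k)).
  have : (1 + k * t) * j * (1 + k) * (1 - r * (1 + k)) = 1 + k.
    by rewrite -star -mulrA pz -mulrA jt mulr1.
  move=> /(congr1 (fun x => (1 - t) * (q * x))) <-.
  by rewrite -!mulrA (mulrA q) qk mul1r (mulrA _ j) tj mul1r.
by rewrite key mulrA et -yq mulrA -[_ * _ * q]mulrA kq mulr1.
Qed.

(** The resolvent identities [R0 - S = S D R0 = R0 D S], used one inside the other. In this
    symmetric form the leading term [S D S] shows its sign, that of [D], for Hermitian [S]. *)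
Lemma resolvent_comparison (K0 D T S R0 q p : A) :
  q * (1 - T * K0) = 1 -> (1 - K0 * T) * p = 1 ->
  (1 - T * K0) * S = T -> S * (1 - K0 * T) = T ->
  (1 - T * (K0 + D)) * R0 = T -> R0 * (1 - (K0 + D) * T) = T ->
  R0 = S + (S * D * S + S * D * R0 * D * S).
Proof.
move=> q1 p1 TS ST TR RT.
have S1 : q * T = S by rewrite -TS mulrA q1 mul1r.
have S2 : T * p = S by rewrite -ST -mulrA p1 mulr1.
have H1 : R0 - S = S * D * R0.
  have : (1 - T * K0) * (R0 - S) = T * D * R0.
    rewrite mulrBr TS -{2}TR -mulrBl; congr (_ * _).
    by rewrite mulrDr opprB addrC addrA subrK addrC addKr.
  by move=> /(congr1 (fun x => q * x)); rewrite !mulrA q1 mul1r S1.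
have H2 : R0 - S = R0 * D * S.
  have : (R0 - S) * (1 - K0 * T) = R0 * D * T.
    rewrite mulrBl ST -{2}RT -mulrBr -mulrA; congr (_ * _).
    by rewrite mulrDl opprB addrC addrA subrK addrC addKr.
  by move=> /(congr1 (fun x => x * p)); rewrite -!mulrA p1 mulr1 S2 !mulrA.
have RS : R0 = S + R0 * D * S by rewrite -H2 addrC subrK.
have -> : S * D * S + S * D * R0 * D * S = S * D * R0.
  by rewrite [in RHS]RS mulrDr !mulrA.
by rewrite -H1 addrC subrK.
Qed.

End CayleyAlgebra.

(** * A submultiplicative norm and its control of quadratic forms *)

Section EntrywiseNorm.
Variable R : realType.
Local Notation C := R[i].
Local Notation normc := (@Normc.normc R).

(* The l1 norm of the entries: submultiplicative for free. *)
Definition nrm m n (M : 'M[C]_(m, n)) : R := \sum_i \sum_j normc (M i j).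

Lemma normc_ge0 (z : C) : 0 <= normc z.
Proof. by case: z => a b; apply: sqrtr_ge0. Qed.

Lemma nrm_ge0 m n (M : 'M[C]_(m, n)) : 0 <= nrm M.
Proof. by rewrite sumr_ge0 // => i _; rewrite sumr_ge0 // => j _; apply: normc_ge0. Qed.

Lemma nrmD m n (M N : 'M[C]_(m, n)) : nrm (M + N) <= nrm M + nrm N.
Proof.
rewrite -big_split ler_sum // => i _; rewrite -big_split ler_sum // => j _.
by rewrite mxE le_normcD.
Qed.

Lemma nrmN m n (M : 'M[C]_(m, n)) : nrm (- M) = nrm M.
Proof. by apply: eq_bigr => i _; apply: eq_bigr => j _; rewrite mxE normcN. Qed.

Lemma nrm_entry m n (M : 'M[C]_(m, n)) i j : normc (M i j) <= nrm M.
Proof.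
rewrite /nrm (bigD1 i) //= (bigD1 j) //= -addrA lerDl.
rewrite addr_ge0 // sumr_ge0 // => k _; first exact: normc_ge0.
by rewrite sumr_ge0 // => l _; apply: normc_ge0.
Qed.

Lemma nrm_eq0 m n (M : 'M[C]_(m, n)) : nrm M <= 0 -> M = 0.
Proof.
move=> M0; apply/matrixP => i j; rewrite mxE.
by apply: Normc.eq0_normc; apply/eqP; rewrite eq_le normc_ge0 (le_trans (nrm_entry M i j)).
Qed.

Lemma normc_sum (I : Type) (s : seq I) (P : pred I) (F : I -> C) :
  normc (\sum_(i <- s | P i) F i) <= \sum_(i <- s | P i) normc (F i).
Proof.
elim/big_ind2: _ => [|x1 x2 y1 y2 h1 h2|//]; first by rewrite Normc.normc0.
by rewrite (le_trans (le_normcD _ _)) // lerD.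
Qed.

Lemma nrmM m n p (M : 'M[C]_(m, n)) (N : 'M[C]_(n, p)) :
  nrm (M *m N) <= nrm M * nrm N.
Proof.
rewrite mulr_suml ler_sum // => i _.
apply: (@le_trans _ _ (\sum_k \sum_j normc (M i j) * normc (N j k))).
  rewrite ler_sum // => k _; rewrite mxE (le_trans (normc_sum _ _ _)) //.
  by rewrite ler_sum // => j _; rewrite Normc.normcM.
rewrite exchange_big /= mulr_suml ler_sum // => j _.
rewrite -mulr_sumr ler_wpM2l ?normc_ge0 //.
rewrite /nrm (bigD1 j) //= lerDl sumr_ge0 // => l _.
by rewrite sumr_ge0 // => q _; apply: normc_ge0.
Qed.

Lemma normc_conj (z : C) : normc (z^*) = normc z.
Proof. by case: z => a b /=; rewrite sqrrN. Qed.

Lemma nrm_adj m n (M : 'M[C]_(m, n)) : nrm (M ^t*) = nrm M.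
Proof.
rewrite /nrm exchange_big; apply: eq_bigr => i _; apply: eq_bigr => j _.
by rewrite !mxE normc_conj.
Qed.

(** A nonzero row vector fixed by [M] would satisfy [nrm v <= nrm v * nrm M]. *)
Lemma unitmx_one_sub n (M : 'M[C]_n) : nrm M < 1 -> 1%:M - M \in unitmx.
Proof.
move=> M1; rewrite unitmxE unitfE; apply/det0P => -[v v0].
rewrite mulmxBr mulmx1 => /subr0_eq vM; have := nrmM v M; rewrite -vM.
have v_gt0 : 0 < nrm v.
  rewrite lt_neqAle nrm_ge0 andbT eq_sym; apply: contra v0 => /eqP v0.
  by apply/eqP/nrm_eq0; rewrite v0.
by rewrite ler_pMr // leNgt M1.
Qed.

Lemma qform_herm_real n (M : 'M[C]_n) v : M ^t* = M -> qform M v \is Num.real.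
Proof.
move=> Mh; apply/CrealP; have : (v ^t* *m M *m v) ^t* = v ^t* *m M *m v.
  by rewrite !adjM trmxCK Mh mulmxA.
by move=> /matrixP/(_ 0 0); rewrite mxE mxE.
Qed.

(** Every product |v_i| |v_j| is at most the sum of all |v_k|^2. The order of [C] compares values
    only when their difference is real, which holds because [M] is Hermitian. *)
Lemma qform_le_nrm n (M : 'M[C]_n) v : M ^t* = M ->
  qform M v <= (nrm M)%:C%C * qform 1%:M v.
Proof.
move=> Mh; apply: (le_trans (real_ler_norm (qform_herm_real v Mh))).
rewrite qform1 /qform -mulmxA mxE (le_trans (ler_norm_sum _ _ _)) //.
rewrite rmorph_sum mulr_suml ler_sum // => i _.
rewrite normrM !mxE norm_conjC rmorph_sum mulr_suml.
apply: le_trans (ler_wpM2l (normr_ge0 _) (ler_norm_sum _ _ _)) _.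
rewrite mulr_sumr ler_sum // => j _; rewrite normrM.
set S := \sum_(k < n) _.
have le_S k : `|v k 0| ^+ 2 <= S.
  by rewrite /S (bigD1 k) //= lerDl sumr_ge0 // => l _; rewrite exprn_ge0.
rewrite mulrCA ler_wpM2l //.
have : 2 * (`|v i 0| * `|v j 0|) <= 2 * S.
  apply: (@le_trans _ _ (`|v i 0| ^+ 2 + `|v j 0| ^+ 2)).
    rewrite -subr_ge0; apply: (@le_trans _ _ ((`|v i 0| - `|v j 0|) ^+ 2)).
      by rewrite real_exprn_even_ge0 // realB.
    by rewrite le_eqVlt; apply/orP; left; apply/eqP; ring.
  by rewrite mulr_natl mulr2n lerD.
by rewrite ler_pM2l.
Qed.

Lemma qform_ge_nrm n (M : 'M[C]_n) v : M ^t* = M ->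
  - ((nrm M)%:C%C * qform 1%:M v) <= qform M v.
Proof.
move=> Mh; rewrite lerNl -qformN -nrmN; apply: qform_le_nrm.
by rewrite adjN Mh.
Qed.

End EntrywiseNorm.

(** * Phases and the scalar Cayley transform *)

Section UnitCircle.
Variable R : realType.
Local Notation C := R[i].

Definition cis (a : R) : C := (cos a +i* sin a)%C.

Lemma cisD a b : cis (a + b) = cis a * cis b.
Proof.
by apply/eqP; rewrite eq_complex /= cosD sinD; apply/andP; split; apply/eqP; ring.
Qed.

Lemma cis0 : cis 0 = 1.
Proof. by rewrite /cis cos0 sin0. Qed.

Lemma cisN a : cis (- a) = (cis a)^*.
Proof. by rewrite /cis cosN sinN. Qed.

Lemma cis_sum (I : Type) (s : seq I) (P : pred I) (F : I -> R) :
  cis (\sum_(i <- s | P i) F i) = \prod_(i <- s | P i) cis (F i).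
Proof. by rewrite (big_morph _ cisD cis0). Qed.

(** From cos a = 1 follows sin (a / 2) = 0, while |a / 2| < pi. This turns equalities of phases into
    equalities of angles. *)
Lemma cis_eq1 a : `|a| < 2 * pi -> cis a = 1 -> a = 0.
Proof.
move=> a2pi [ca1 _].
have : sin (a / 2) = 0.
  have h : 1 = cos (a / 2) ^+ 2 *+ 2 - 1.
    by rewrite -cos_mulr2n mulr2n -splitr ca1.
  have h2 := cos2Dsin2 (a / 2); apply/eqP; rewrite -sqrf_eq0; apply/eqP; lra.
have [a0|a0|//] := ltgtP a 0.
  move=> s0; have : 0 < sin (- (a / 2)).
    apply: sin_gt0_pi; have := ltr0_norm a0; lra.
  by rewrite sinN s0 oppr0 ltxx.
move=> s0; have : 0 < sin (a / 2).
  apply: sin_gt0_pi; have := gtr0_norm a0; lra.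
by rewrite s0 ltxx.
Qed.

(** The Cayley transform doubles angles: this is the source of the half angles in all later
    tangents. *)
Lemma cis_tan p : cos p != 0 ->
  1 + 'i * (tan p)%:C%C = (1 - 'i * (tan p)%:C%C) * cis (p + p) :> C.
Proof.
move=> c0; rewrite cisD; apply/eqP; rewrite eq_complex /= /tan.
have cs := cos2Dsin2 p; set c := cos p in c0 cs *; set s := sin p in cs *.
have s2 : s * s = 1 - c * c by rewrite -!expr2; lra.
apply/andP; split; apply/eqP.
  transitivity (c * c + s * s); first by rewrite s2; ring.
  by field.
transitivity ((s / c) * (c * c + s * s)); first by rewrite s2; field.
by field.
Qed.

Lemma cos_atan_neq0 (x : R) : cos (atan x) != 0.
Proof. by rewrite gt_eqF // cos_gt0_pihalf // atan_gtNpi2 atan_ltpi2. Qed.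

Lemma cis_atan x :
  1 + 'i * (x)%:C%C = (1 - 'i * (x)%:C%C) * cis (atan x + atan x) :> C.
Proof. by have := cis_tan (cos_atan_neq0 x); rewrite atanK. Qed.

Lemma one_sub_i_neq0 (x : R) : 1 - 'i * (x)%:C%C != 0 :> C.
Proof.
apply/eqP => /(congr1 (@complex.Re R)) /=.
rewrite !(mul0r, mul1r, mulr0, oppr0, subr0, addr0, add0r, opprK).
by move/eqP; rewrite oner_eq0.
Qed.

Lemma atan_lipschitz (x y : R) : `|atan x - atan y| <= `|x - y|.
Proof.
wlog xy : x y / y < x.
  move=> H; have [xy|xy|->] := ltgtP x y; last by rewrite !subrr.
    by rewrite distrC (distrC x) H.
  exact: H.
have datan z : z \in `]y, x[ -> is_derive z 1 (@atan R) (1 + z ^+ 2)^-1.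
  by move=> _; exact: is_derive1_atan.
have catan : {within `[y, x], continuous (@atan R)}.
  by apply: derivable_within_continuous => z _; exact: ex_derive.
have [c _ ->] := MVT xy datan catan.
rewrite normrM ler_piMl // ger0_norm ?invr_ge0.
  by rewrite invf_le1 ?lerDl ?sqr_ge0 // ltr_pwDl // sqr_ge0.
by rewrite addr_ge0 // sqr_ge0.
Qed.

End UnitCircle.

(** * Eigenvalue perturbation, resolvents and the matrix Cayley transform *)

Section SpectralPerturbation.
Variable R : realType.
Local Notation C := R[i].

Lemma conjU_rdiag_shift n (W : 'M[C]_n) (a : nat -> R) c : W \is unitarymx ->
  conjU W (rdiag n (fun j => a j + c)) = conjU W (rdiag n a) + (c%:C%C)%:M.
Proof.
move=> Wu; rewrite -(conjUs (c%:C%C) Wu) -conjUD -cdiag_cst cdiagD.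
by congr conjU; apply: eq_cdiag => j _; rewrite rmorphD.
Qed.

(** Weyl's inequality: shifting [a] by the norm of the difference makes the forms comparable, and
    Courant-Fischer applies with [V = 1]. *)
Lemma eigenvalue_le_nrm n (W X : 'M[C]_n) (a b : nat -> R) :
  W \is unitarymx -> X \is unitarymx -> nonincr n a -> nonincr n b ->
  forall i, (i < n)%N ->
  b i <= a i + nrm (conjU X (rdiag n b) - conjU W (rdiag n a)).
Proof.
move=> Wu Xu sa sb i lin; set N := _ - _.
have Nh : N ^t* = N by rewrite adjD adjN !adj_conjU !adj_rdiag.
apply: (@eigenvalue_compression R n n (fun j => a j + nrm N) b W X 1%:M) => //.
- by rewrite adj1 mulmx1.
- by move=> j k jk kn; rewrite lerD2r sa.
move=> v; rewrite mul1mx conjU_rdiag_shift // qformD -scalemx1 qformZ.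
rewrite -lerBlDl -qformN -qformD; exact: qform_le_nrm.
Qed.

Lemma eigenvalue_dist n (W X : 'M[C]_n) (a b : nat -> R) :
  W \is unitarymx -> X \is unitarymx -> nonincr n a -> nonincr n b ->
  forall i, (i < n)%N ->
  `|b i - a i| <= nrm (conjU X (rdiag n b) - conjU W (rdiag n a)).
Proof.
move=> Wu Xu sa sb i lin; rewrite ler_distlC; apply/andP; split.
  by rewrite lerBlDr; apply: eigenvalue_le_nrm.
by rewrite -nrmN opprB; apply: eigenvalue_le_nrm.
Qed.

Lemma eigenvalue_small n (W : 'M[C]_n) (a : nat -> R) : W \is unitarymx ->
  nonincr n a -> forall i, (i < n)%N -> `|a i| <= nrm (conjU W (rdiag n a)).
Proof.
move=> Wu sa i lin.
have -> : conjU W (rdiag n a) =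
    conjU W (rdiag n a) - conjU 1%:M (rdiag n (fun=> 0)).
  have -> : rdiag n (fun=> 0) = 0 :> 'M[C]_n.
    by rewrite /rdiag cdiag_cst raddf0.
  by rewrite /conjU mulmx0 mul0mx subr0.
have u1 := @unitarymx1 R n.
have s0 : nonincr n (fun=> 0 : R) by [].
by have := eigenvalue_dist u1 Wu s0 sa lin; rewrite subr0.
Qed.

(** [S = T (1 - K T)^-1]; the norm bound follows from [S = T + S K T] with [K T] of norm at most
    1/2. *)
Lemma resolvent_exists n (K T : 'M[C]_n) : nrm K * nrm T <= 2^-1 ->
  exists S, [/\ (1%:M - T *m K) *m S = T, S *m (1%:M - K *m T) = T
    & nrm S <= 2 * nrm T].
Proof.
move=> KT2; have KT1 : 1%:M - K *m T \in unitmx.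
  by apply: unitmx_one_sub; apply: le_lt_trans (nrmM _ _) _; lra.
pose S := T *m invmx (1%:M - K *m T); exists S.
have ST : S *m (1%:M - K *m T) = T by rewrite mulmxKV.
have TS : (1%:M - T *m K) *m S = T.
  rewrite /S mulmxA -[RHS](mulmxK KT1); congr (_ *m _).
  by rewrite mulmxBl mulmxBr mul1mx mulmx1 mulmxA.
split=> //; have ST' : S = T + S *m (K *m T).
  by move: ST; rewrite mulmxBr mulmx1 => {1}<-; rewrite subrK.
have := nrmD T (S *m (K *m T)); rewrite -ST' => le1.
have := nrmM S (K *m T); have := nrmM K T; have := nrm_ge0 S.
have := nrm_ge0 (K *m T) => h1 h2 h3 h4.
have : nrm S * nrm (K *m T) <= nrm S * 2^-1 by rewrite ler_wpM2l // (le_trans h3).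
lra.
Qed.

(** Taking adjoints exchanges the two equations of the resolvent, and [1 - T K] is invertible. *)
Lemma resolvent_herm n (K T S : 'M[C]_n) : K ^t* = K -> T ^t* = T ->
  1%:M - T *m K \in unitmx ->
  (1%:M - T *m K) *m S = T -> S *m (1%:M - K *m T) = T -> S ^t* = S.
Proof.
move=> Kh Th u TS ST; apply: (can_inj (mulKmx u)); rewrite TS.
by rewrite -[RHS]Th -[X in _ = X ^t*]ST [RHS]adjM adjD adj1 adjN adjM Kh Th.
Qed.

Definition iZ n (A : 'M[C]_n) : 'M[C]_n := 'i *: A.

Lemma iZM n (A B : 'M[C]_n) : iZ A *m iZ B = - (A *m B).
Proof.
by rewrite /iZ -scalemxAl -scalemxAr scalerA -expr2 sqrCi scaleN1r.
Qed.

Lemma cayley_add_iZ n (K S : 'M[C]_n) : cayley_add (iZ K) (iZ S) =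
  iZ (K + (1%:M - iZ K) *m S *m (1%:M + iZ K)).
Proof.
rewrite /cayley_add /iZ scalerDr; congr (_ + _).
transitivity ((1%:M - 'i *: K) *m ('i *: S) *m (1%:M + 'i *: K)) => //.
by rewrite -scalemxAr -scalemxAl.
Qed.

Lemma invr2D : 2^-1 + 2^-1 = 1 :> C.
Proof. by rewrite [RHS]splitr mul1r. Qed.

(** The inverse is [(E + 1) / 2], because [(E + 1)(1 - T) = (1 + T) + (1 - T) = 2]. *)
Lemma inv_of_cayley n (E T : 'M[C]_n) : E *m (1%:M - T) = 1%:M + T ->
  1%:M - T \in unitmx.
Proof.
move=> ET; have : (2^-1 *: (E + 1%:M)) *m (1%:M - T) = 1%:M.
  rewrite -scalemxAl mulmxDl ET mul1mx addrACA subrr addr0 scalerDr -scalerDl.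
  by rewrite invr2D scale1r.
by move=> /mulmx1_unit[].
Qed.

(** Both [1 - i L] and [1 - i M] are inverse to [(U + 1) / 2]. *)
Lemma cayley_eq n (U L M : 'M[C]_n) :
  U *m (1%:M - iZ L) = 1%:M + iZ L -> U *m (1%:M - iZ M) = 1%:M + iZ M -> L = M.
Proof.
move=> UL UM; have uM := inv_of_cayley UM; have uL := inv_of_cayley UL.
have E (N : 'M[C]_n) : U *m (1%:M - iZ N) = 1%:M + iZ N ->
    2^-1 *: (U + 1%:M) *m (1%:M - iZ N) = 1%:M.
  move=> UN; rewrite -scalemxAl mulmxDl UN mul1mx addrACA subrr addr0 scalerDr -scalerDl.
  by rewrite invr2D scale1r.
have LM : 1%:M - iZ L = 1%:M - iZ M.
  rewrite -[LHS]mulmx1 -[X in _ *m X = _](E _ UM) mulmxA.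
  have /mulmx1C -> := E _ UL.
  by rewrite mul1mx.
have : iZ L = iZ M by apply/oppr_inj/(addrI 1%:M).
by apply: scalerI; rewrite neq0Ci.
Qed.

(** By injectivity of the Cayley transform, it suffices that the right-hand side has transform
    [E D], which is [cayley_mul]. In the application [E] is exp(ihx) and [D] is i u(t). *)
Lemma cayley_perturbation n (K T L E D S : 'M[C]_n) :
  1%:M - K *m T \in unitmx ->
  (1%:M - T *m K) *m S = T -> S *m (1%:M - K *m T) = T ->
  E *m (1%:M - iZ T) = 1%:M + iZ T -> D *m (1%:M - iZ K) = 1%:M + iZ K ->
  E *m D *m (1%:M - iZ L) = 1%:M + iZ L ->
  L = K + (1%:M - iZ K) *m S *m (1%:M + iZ K).
Proof.
move=> uq TS ST ET DK EDL; apply: (cayley_eq EDL).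
have uT := inv_of_cayley ET.
rewrite -cayley_add_iZ.
have q1 : 1 + iZ K * iZ T = 1%:M - K *m T by rewrite -iZM.
have p1 : 1 + iZ T * iZ K = 1%:M - T *m K by rewrite -iZM.
apply: (@cayley_mul _ (iZ K) (iZ T) (iZ S) E D (invmx (1%:M - K *m T))
  (invmx (1%:M - iZ T))) => //.
- exact: mulmxV.
- exact: mulVmx.
- by rewrite q1; apply: mulVmx.
- by rewrite q1; apply: mulmxV.
- by rewrite p1 /iZ -[X in _ = 'i *: X]TS; apply: esym; apply: scalemxAr.
- by rewrite q1 /iZ -[X in _ = 'i *: X]ST; apply: esym; apply: scalemxAl.
Qed.

(** With [w = S v], the form is at least the sum of d_j (1 - nrm R0 d_j) |w_j|^2. *)
Lemma qform_resolvent n (Dl S R0 : 'M[C]_n) (d : nat -> R) v :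
  Dl = rdiag n d -> S ^t* = S -> R0 ^t* = R0 ->
  (forall j, (j < n)%N -> 0 <= d j /\ nrm R0 * d j <= 1) ->
  0 <= qform (S *m Dl *m S + S *m Dl *m R0 *m Dl *m S) v.
Proof.
move=> -> Sh Rh dj; rewrite qformD -[X in X *m _ *m S]Sh qform_conj.
have -> : S *m rdiag n d *m R0 *m rdiag n d *m S =
    (rdiag n d *m S) ^t* *m R0 *m (rdiag n d *m S).
  by rewrite adjM Sh adj_rdiag !mulmxA.
rewrite qform_conj -mulmxA; set w := S *m v.
apply: le_trans (lerD (lexx _) (qform_ge_nrm (rdiag n d *m w) Rh)).
rewrite qform1 qform_cdiag mulr_sumr -sumrB sumr_ge0 // => j _.
have [d0 d1] := dj j (ltn_ord j).
rewrite mul_diag_mx !mxE normrM exprMn (ger0_norm (_ : 0 <= (d j)%:C%C)) ?ler0c //.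
rewrite [X in _ - X]mulrA -mulrBl mulr_ge0 ?exprn_ge0 //.
rewrite -rmorphXn -rmorphM -rmorphB ler0c subr_ge0.
by rewrite expr2 mulrA ler_piMl.
Qed.

(** The isometry onto the span V of the overview, in coordinates where [u(t)] is diagonal. *)
Definition firsts m n : 'M[C]_(n, m) := \matrix_(i, j) (i == j :> nat)%:R.

Lemma firsts_isometry m n : (m <= n)%N -> (firsts m n) ^t* *m firsts m n = 1%:M.
Proof.
move=> lemn; apply/matrixP => i j; rewrite !mxE (bigD1 (widen_ord lemn i)) //=.
rewrite !mxE /= eqxx conjC1 mul1r big1 ?addr0 // => k ki; rewrite !mxE.
by rewrite [_ == i :> nat](negbTE _) ?conjC0 ?mul0r //; move: ki; rewrite -val_eqE.
Qed.

Lemma cdiag_firsts m n (d : nat -> C) :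
  cdiag n d *m firsts m n = firsts m n *m cdiag m d.
Proof.
apply/matrixP => i j; rewrite mul_diag_mx mul_mx_diag !mxE.
by case: eqP => [->|_]; rewrite ?mulr0 ?mul0r // mulr1 mul1r.
Qed.

Lemma cdiag_firsts_conj m n (d : nat -> C) : (m <= n)%N ->
  firsts m n *m cdiag m d *m (firsts m n) ^t* =
  cdiag n (fun j => if (j < m)%N then d j else 0).
Proof.
move=> lemn; rewrite -cdiag_firsts -mulmxA.
apply/matrixP => i j; rewrite mul_diag_mx !mxE.
have [lim|lemi] := ltnP i m; last first.
  rewrite mul0rn big1 ?mulr0 // => k _; rewrite !mxE gtn_eqF ?mul0r //.
  exact: leq_trans lemi.
rewrite (bigD1 (Ordinal lim)) //= big1 ?addr0 => [|k ki].
  rewrite !mxE eqxx mul1r; have [ij|ij] := eqVneq i j.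
    by rewrite (_ : (j == Ordinal lim :> nat) = true) ?conjC1 ?mulr1 //= -ij eqxx.
  by rewrite (_ : (j == Ordinal lim :> nat) = false) ?conjC0 ?mulr0 // eq_sym; apply/negbTE.
rewrite !mxE (_ : (i == k :> nat) = false) ?mul0r // eq_sym; apply/negbTE.
by move: ki; rewrite -val_eqE.
Qed.

End SpectralPerturbation.

(** * Addition of phases through determinants, and continuity of the tangents *)

Section LocalBound.
Variable R : realType.
Local Notation C := R[i].

Lemma iZ_conjU n (W : 'M[C]_n) (d : nat -> R) :
  iZ (conjU W (rdiag n d)) = conjU W (cdiag n (fun j => 'i * (d j)%:C%C)).
Proof. by rewrite /iZ -conjUZ cdiagZ. Qed.

Lemma one_add_iZ_conjU n (W : 'M[C]_n) (d : nat -> R) : W \is unitarymx ->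
  1%:M + iZ (conjU W (rdiag n d)) = conjU W (cdiag n (fun j => 1 + 'i * (d j)%:C%C)).
Proof. by move=> Wu; rewrite iZ_conjU -(conjU1 Wu) -conjUD -cdiag_cst cdiagD. Qed.

Lemma one_sub_iZ_conjU n (W : 'M[C]_n) (d : nat -> R) : W \is unitarymx ->
  1%:M - iZ (conjU W (rdiag n d)) = conjU W (cdiag n (fun j => 1 - 'i * (d j)%:C%C)).
Proof.
move=> Wu; rewrite iZ_conjU -(conjU1 Wu) -conjUN -conjUD -cdiag_cst; congr conjU.
rewrite -scaleN1r cdiagZ cdiagD; apply: eq_cdiag => j _; by rewrite mulN1r.
Qed.

Lemma prod_one_add_i m (d : nat -> R) :
  \prod_(j < m) (1 + 'i * (d j)%:C%C) =
  \prod_(j < m) (1 - 'i * (d j)%:C%C) * cis (2 * \sum_(j < m) atan (d j)) :> C.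
Proof.
rewrite mulr_sumr cis_sum -big_split; apply: eq_bigr => j _ /=.
by rewrite cis_atan mulr_natl mulr2n.
Qed.

Lemma prod_one_sub_i_neq0 m (d : nat -> R) :
  \prod_(j < m) (1 - 'i * (d j)%:C%C) != 0 :> C.
Proof. by apply/prodf_neq0 => j _; apply: one_sub_i_neq0. Qed.

(** Determinants commute, so the factorization of [1 + cayley_add k r] becomes a product formula
    even when [k] and [t] do not commute. *)
Lemma det_one_add_cayley_add m (k t r : 'M[C]_m) : r *m (1%:M + k *m t) = t ->
  \det (1%:M + cayley_add k r) * \det (1%:M + k *m t) =
  \det (1%:M + t) * \det (1%:M + k).
Proof.
move=> rq; pose X := 1%:M + (1%:M - k) *m r.
have f1 : \det (1%:M + cayley_add k r) = \det X * \det (1%:M + k).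
  by rewrite -det_mulmx; congr (\det _); apply: one_add_cayley_add.
have f2 : \det X * \det (1%:M + k *m t) = \det (1%:M + t).
  by rewrite -det_mulmx; congr (\det _); apply: resolvent_left.
apply: etrans (congr1 (fun z => z * _) f1) _; apply: etrans (mulrAC _ _ _) _.
exact: (congr1 (fun z => z * _) f2).
Qed.

Lemma det_one_sub_cayley_add m (k t r : 'M[C]_m) : (1%:M + t *m k) *m r = t ->
  \det (1%:M - cayley_add k r) * \det (1%:M + t *m k) =
  \det (1%:M - t) * \det (1%:M - k).
Proof.
move=> pr; pose X := 1%:M - r *m (1%:M + k).
have f1 : \det (1%:M - cayley_add k r) = \det (1%:M - k) * \det X.
  by rewrite -det_mulmx; congr (\det _); apply: one_sub_cayley_add.
have f2 : \det (1%:M + t *m k) * \det X = \det (1%:M - t).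
  by rewrite -det_mulmx; congr (\det _); apply: resolvent_right.
apply: etrans (congr1 (fun z => z * _) f1) _; apply: etrans (mulrC _ _) _.
apply: etrans (mulrCA _ _ _) _; apply: etrans (mulrC _ _) _.
exact: (congr1 (fun z => z * _) f2).
Qed.

(** A case of Sylvester's identity, by similarity: [K (1 - t K) = (1 - K t) K]. *)
Lemma det_one_sub_mulC m (K t : 'M[C]_m) : \det K != 0 ->
  \det (1%:M - t *m K) = \det (1%:M - K *m t).
Proof.
move=> dK; have Kt : K *m (1%:M - t *m K) = (1%:M - K *m t) *m K.
  by rewrite mulmxBr mulmxBl mulmx1 mul1mx mulmxA.
apply: (mulfI dK); apply: etrans (esym (det_mulmx _ _)) _.
apply: etrans (congr1 (fun X : 'M[C]_m => \det X) Kt) _.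
by apply: etrans (det_mulmx _ _) _; apply: mulrC.
Qed.

(** Division of the two determinant identities. Each [p] will be a product of factors [1 - i d_j],
    each [c] a phase, and [d] the determinant of [1 - K t], which is nonzero because the second
    identity has a nonzero right-hand side. *)
Lemma phase_cancel (xL xt xK yL yt yK pL pt pK cL ct cK d : C) :
  xL = pL * cL -> xt = pt * ct -> xK = pK * cK -> yL = pL -> yt = pt -> yK = pK ->
  xL * d = xt * xK -> yL * d = yt * yK -> pL != 0 -> pt != 0 -> pK != 0 ->
  cL = ct * cK.
Proof.
move=> -> -> -> -> -> -> e1 e2 pL0 pt0 pK0; have d0 : d != 0.
  apply/eqP => d0; move: e2; rewrite d0 mulr0 => /esym/eqP.
  by rewrite mulf_eq0 (negbTE pt0) (negbTE pK0).
apply: (mulfI (mulf_neq0 pL0 d0)); rewrite mulrAC e1 e2; ring.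
Qed.

(** The quotient of det (1 + i L) by det (1 - i L) is the phase of angle 2 sum atan b_j, and the
    determinant formulas make such quotients multiply. They see angles modulo 2 pi only, hence [cis]
    on both sides. *)
Lemma cayley_add_phase m (a b tau : nat -> R) (Q Z s K t L : 'M[C]_m) :
  (forall j, (j < m)%N -> 0 < a j) -> Q \is unitarymx -> Z \is unitarymx ->
  K = rdiag m a -> t = conjU Z (rdiag m tau) -> L = conjU Q (rdiag m b) ->
  (1%:M - t *m K) *m s = t -> s *m (1%:M - K *m t) = t ->
  K + (1%:M - iZ K) *m s *m (1%:M + iZ K) = L ->
  cis (2 * \sum_(j < m) atan (b j)) =
  cis (2 * (\sum_(j < m) atan (a j) + \sum_(j < m) atan (tau j))).
Proof.
move=> a0 Qu Zu Kd td Ld ts st defL; have u1 := @unitarymx1 R m.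
have K1 : K = conjU 1%:M (rdiag m a) by rewrite /conjU adj1 mul1mx mulmx1.
have dK : \det K != 0.
  rewrite Kd det_cdiag; apply/prodf_neq0 => j _; rewrite gt_eqF // ltcR.
  exact: a0.
have q1 : 1%:M + iZ K *m iZ t = 1%:M - K *m t by rewrite iZM.
have p1 : 1%:M + iZ t *m iZ K = 1%:M - t *m K by rewrite iZM.
have e1 : \det (1%:M + iZ L) * \det (1%:M - K *m t) =
    \det (1%:M + iZ t) * \det (1%:M + iZ K).
  rewrite -q1 -defL -cayley_add_iZ; apply: det_one_add_cayley_add.
  by rewrite q1 /iZ -scalemxAl st.
have e2 : \det (1%:M - iZ L) * \det (1%:M - K *m t) =
    \det (1%:M - iZ t) * \det (1%:M - iZ K).
  rewrite -(det_one_sub_mulC t dK) -p1 -defL -cayley_add_iZ.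
  by apply: det_one_sub_cayley_add; rewrite p1 /iZ -scalemxAr ts.
have Padd (W X : 'M[C]_m) d : W \is unitarymx -> X = conjU W (rdiag m d) ->
    \det (1%:M + iZ X) =
    \prod_(j < m) (1 - 'i * (d j)%:C%C) * cis (2 * \sum_(j < m) atan (d j)).
  by move=> Wu ->; rewrite one_add_iZ_conjU // det_conjU // det_cdiag prod_one_add_i.
have Psub (W X : 'M[C]_m) d : W \is unitarymx -> X = conjU W (rdiag m d) ->
    \det (1%:M - iZ X) = \prod_(j < m) (1 - 'i * (d j)%:C%C).
  by move=> Wu ->; rewrite one_sub_iZ_conjU // det_conjU // det_cdiag.
rewrite mulrDr cisD [RHS]mulrC.
apply: (phase_cancel (Padd _ _ _ Qu Ld) (Padd _ _ _ Zu td) (Padd _ _ _ u1 K1)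
  (Psub _ _ _ Qu Ld) (Psub _ _ _ Zu td) (Psub _ _ _ u1 K1) e1 e2);
  exact: prod_one_sub_i_neq0.
Qed.

Lemma sum_atan_le m (c : R) (d e : nat -> R) :
  (forall i, (i < m)%N -> `|d i - e i| <= c) ->
  `|\sum_(i < m) atan (d i) - \sum_(i < m) atan (e i)| <= m%:R * c.
Proof.
move=> de; rewrite -sumrB (le_trans (ler_norm_sum _ _ _)) //.
rewrite mulr_natl -[X in _ *+ X]card_ord -sumr_const ler_sum // => i _.
by rewrite (le_trans (atan_lipschitz _ _)) // de.
Qed.

(** The constant depends on [a] alone and is fixed before [T]: letting [T] tend to 0 gives
    continuity at one time. *)
Lemma cayley_continuity n (a : nat -> R) (K := rdiag n a) : nonincr n a ->
  exists2 c : R, 0 <= c & forall (T E D Y : 'M[C]_n) (al : nat -> R),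
    c * nrm T <= 1 ->
    E *m (1%:M - iZ T) = 1%:M + iZ T -> D *m (1%:M - iZ K) = 1%:M + iZ K ->
    Y \is unitarymx -> nonincr n al ->
    E *m D *m (1%:M - iZ (conjU Y (rdiag n al))) = 1%:M + iZ (conjU Y (rdiag n al)) ->
    forall i, (i < n)%N -> `|al i - a i| <= c * nrm T.
Proof.
(* In the constant, [2 * nrm K] ensures [nrm K * nrm T <= 1/2], so that the resolvent exists with
   norm at most [2 * nrm T]; then [g * nrm T] bounds the change of [K]. *)
move=> sa; pose g := nrm (1%:M - iZ K) * (2 * nrm (1%:M + iZ K)).
have g0 : 0 <= g by rewrite !mulr_ge0 ?nrm_ge0.
have K0 := nrm_ge0 K; exists (2 * nrm K + g); first by rewrite addr_ge0 // mulr_ge0.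
move=> T E D Y al cT ET DK Yu sal EDL i lin; have T0 := nrm_ge0 T.
have gT0 : 0 <= g * nrm T by rewrite mulr_ge0.
have KT0 : 0 <= nrm K * nrm T by rewrite mulr_ge0.
have KT : nrm K * nrm T <= 2^-1 by move: cT; rewrite mulrDl -mulrA; lra.
have [S [TS ST nS]] := resolvent_exists KT.
have uq : 1%:M - K *m T \in unitmx.
  by apply: unitmx_one_sub; apply: le_lt_trans (nrmM _ _) _; lra.
have defL := cayley_perturbation uq TS ST ET DK EDL.
have u1 := @unitarymx1 R n.
have K1 : K = conjU 1%:M (rdiag n a) by rewrite /conjU adj1 mul1mx mulmx1.
apply: le_trans (eigenvalue_dist u1 Yu sa sal lin) _; rewrite -K1 defL addrC addKr.
apply: (@le_trans _ _ (g * nrm T)); last by rewrite mulrDl lerDr -mulrA mulr_ge0.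
apply: le_trans (nrmM _ _) _.
apply: (@le_trans _ _ (nrm (1%:M - iZ K) * (2 * nrm T) * nrm (1%:M + iZ K))).
  rewrite ler_wpM2r ?nrm_ge0 // (le_trans (nrmM _ _)) // ler_wpM2l ?nrm_ge0 //.
by rewrite /g le_eqVlt; apply/orP; left; apply/eqP; ring.
Qed.

End LocalBound.

(** * The lower bound by compression to the top eigenvectors *)

Section CompressionBound.
Variable R : realType.
Local Notation C := R[i].

Lemma adj_iZ n (A : 'M[C]_n) : A ^t* = A -> (iZ A) ^t* = - iZ A.
Proof. by move=> Ah; rewrite /iZ adjZ Ah conjCi scaleNr. Qed.

Lemma adj_one_add_iZ n (A : 'M[C]_n) : A ^t* = A ->
  (1%:M + iZ A) ^t* = 1%:M - iZ A.
Proof. by move=> Ah; rewrite adjD adj1 adj_iZ. Qed.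

Lemma adj_cayley_form n (K S : 'M[C]_n) : K ^t* = K -> S ^t* = S ->
  (K + (1%:M - iZ K) *m S *m (1%:M + iZ K)) ^t* =
  K + (1%:M - iZ K) *m S *m (1%:M + iZ K).
Proof.
move=> KH SH; have h1 := adj_one_add_iZ KH.
have h2 : (1%:M - iZ K) ^t* = 1%:M + iZ K by rewrite -h1 trmxCK.
by rewrite adjD !adjM KH SH h1 h2 mulmxA.
Qed.

(** [V] intertwines [K] and [K1], hence moves past the outer factors, and only [S] is compressed. *)
Lemma cayley_form m n (V : 'M[C]_(n, m)) (K S : 'M[C]_n) (K1 : 'M[C]_m) :
  V ^t* *m V = 1%:M -> K ^t* = K -> K1 ^t* = K1 -> K *m V = V *m K1 ->
  V ^t* *m (K + (1%:M - iZ K) *m S *m (1%:M + iZ K)) *m V =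
  K1 + (1%:M - iZ K1) *m (V ^t* *m S *m V) *m (1%:M + iZ K1).
Proof.
move=> VV Kh K1h KV.
have p1 : (1%:M + iZ K) *m V = V *m (1%:M + iZ K1).
  by rewrite mulmxDl mulmxDr mul1mx mulmx1 /iZ -scalemxAl KV scalemxAr.
have p2 : V ^t* *m (1%:M - iZ K) = (1%:M - iZ K1) *m V ^t*.
  by have := congr1 (fun X => X ^t*) p1; rewrite !adjM !adj_one_add_iZ.
have p3 : V ^t* *m K *m V = K1 by rewrite -mulmxA KV mulmxA VV mul1mx.
rewrite [V ^t* *m (K + _)]mulmxDr [(_ + _) *m V]mulmxDl p3; congr (_ + _).
by rewrite !mulmxA p2 -!mulmxA p1.
Qed.

(** Since [1 - i K1] is the adjoint of [1 + i K1], the contribution of [N] is its form at the vector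
    [V (1 + i K1) v]. *)
Lemma qform_cayley_le m n (V : 'M[C]_(n, m)) (K S N : 'M[C]_n) (K1 : 'M[C]_m) v :
  V ^t* *m V = 1%:M -> K ^t* = K -> K1 ^t* = K1 -> K *m V = V *m K1 ->
  (forall w, 0 <= qform N w) ->
  qform (K1 + (1%:M - iZ K1) *m (V ^t* *m S *m V) *m (1%:M + iZ K1)) v <=
  qform (K + (1%:M - iZ K) *m (S + N) *m (1%:M + iZ K)) (V *m v).
Proof.
move=> VV Kh K1h KV N0; rewrite -[leRHS]qform_conj (cayley_form (S + N) VV Kh K1h KV).
have -> : (1%:M - iZ K1) *m (V ^t* *m (S + N) *m V) *m (1%:M + iZ K1) =
    (1%:M - iZ K1) *m (V ^t* *m S *m V) *m (1%:M + iZ K1) +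
    (1%:M - iZ K1) *m (V ^t* *m N *m V) *m (1%:M + iZ K1).
  by rewrite -mulmxDl -mulmxDr -mulmxDl -mulmxDr.
rewrite addrA [leRHS]qformD lerDl.
by rewrite -adj_one_add_iZ // !qform_conj.
Qed.

(** One step in the eigenbasis of u(t): [a], [tau] and [al] are the eigenvalues of [K], of the
    compressed [T] and of the updated matrix. Only lower bounds are claimed, but for [T] of either
    sign. *)
Lemma cayley_lower_bound n m (a : nat -> R) (K := rdiag n a) :
  (m <= n)%N -> nonincr n a -> (forall j, (j < n)%N -> 0 < a j) ->
  exists2 c : R, 0 <= c &
  forall (T E D Y : 'M[C]_n) (Z : 'M[C]_m) (al tau : nat -> R),
    T ^t* = T -> c * nrm T <= 1 ->
    E *m (1%:M - iZ T) = 1%:M + iZ T -> D *m (1%:M - iZ K) = 1%:M + iZ K ->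
    Y \is unitarymx -> nonincr n al ->
    E *m D *m (1%:M - iZ (conjU Y (rdiag n al))) = 1%:M + iZ (conjU Y (rdiag n al)) ->
    Z \is unitarymx -> nonincr m tau ->
    (firsts R m n) ^t* *m T *m firsts R m n = conjU Z (rdiag m tau) ->
    \sum_(i < m) atan (a i) + \sum_(i < m) atan (tau i) <= \sum_(i < m) atan (al i).
Proof.
move=> lemn sa a0; pose K1 : 'M[C]_m := rdiag m a; set V := firsts R m n.
(* [ah] keeps the spectrum of [K] on V; [ad] is the nonnegative part to be dropped. *)
pose ah j := if (j < m)%N then a j else 0.
pose ad j := if (j < m)%N then 0 else a j.
pose Kh := rdiag n ah.
have VV : V ^t* *m V = 1%:M by apply: firsts_isometry.
have KV : K *m V = V *m K1 by apply: cdiag_firsts.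
have defKh : V *m K1 *m V ^t* = Kh.
  by rewrite cdiag_firsts_conj //; apply: eq_cdiag => j _; rewrite /ah; case: ifP.
have defK : K = Kh + rdiag n ad.
  rewrite cdiagD; apply: eq_cdiag => j _; rewrite -rmorphD /ah /ad.
  by case: ifP; rewrite ?addr0 ?add0r.
have KhH : Kh ^t* = Kh by apply: adj_rdiag.
have KH : K ^t* = K by apply: adj_rdiag.
have K1H : K1 ^t* = K1 by apply: adj_rdiag.
have K1d : K1 = conjU 1%:M (rdiag m a) by rewrite /conjU adj1 mul1mx mulmx1.
have aK j : (j < n)%N -> a j <= nrm K.
  move=> jn; have := nrm_entry K (Ordinal jn) (Ordinal jn); rewrite !mxE eqxx mulr1n /=.
  by rewrite expr0n addr0 sqrtr_sqr ger0_norm // ltW // a0.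
have K1r : K1 = rdiag m a by [].
clearbody K1 K Kh V.
pose g := nrm (1%:M - iZ K1) * (nrm V * 2 * nrm V) * nrm (1%:M + iZ K1).
pose v := nrm V * nrm V.
have g0 : 0 <= g by rewrite /g !mulr_ge0 ?nrm_ge0 ?ler0n.
have v0 : 0 <= v by rewrite mulr_ge0 ?nrm_ge0.
have mgv0 : 0 <= m%:R * (g + v) by rewrite mulr_ge0 // addr_ge0.
have nK0 := nrm_ge0 K; have nKh0 := nrm_ge0 Kh.
(* The first two terms make both resolvents exist and give [nrm R0 * a j <= 1]; the last keeps the
   displacement of the sums of arctangents at most 1, which is below pi. *)
exists (2 * nrm K + 2 * nrm Kh + m%:R * (g + v)).
  by apply: addr_ge0 => //; apply: addr_ge0; apply: mulr_ge0.
move=> T E D Y Z al tau Th cT ET DK Yu sal EDL Zu stau deft.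
have T0 := nrm_ge0 T; set e := nrm T in T0 cT *.
have e1 : 0 <= nrm K * e by apply: mulr_ge0.
have e2 : 0 <= nrm Kh * e by apply: mulr_ge0.
have e3 : 0 <= m%:R * (g + v) * e by apply: mulr_ge0.
have {cT} cT : 2 * (nrm K * e) + 2 * (nrm Kh * e) + m%:R * (g + v) * e <= 1.
  by move: cT; rewrite !mulrDl -!mulrA.
have nKT : nrm K * nrm T <= 2^-1 by rewrite -/e; lra.
have nKhT : nrm Kh * nrm T <= 2^-1 by rewrite -/e; lra.
have [R0 [TR RT nR]] := resolvent_exists nKT.
have [S [TS ST nS]] := resolvent_exists nKhT.
have uKT : 1%:M - K *m T \in unitmx.
  by apply: unitmx_one_sub; apply: le_lt_trans (nrmM _ _) _; lra.
have uTK : 1%:M - T *m K \in unitmx.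
  by apply: unitmx_one_sub; apply: le_lt_trans (nrmM _ _) _; rewrite mulrC; lra.
have uKhT : 1%:M - Kh *m T \in unitmx.
  by apply: unitmx_one_sub; apply: le_lt_trans (nrmM _ _) _; lra.
have uTKh : 1%:M - T *m Kh \in unitmx.
  by apply: unitmx_one_sub; apply: le_lt_trans (nrmM _ _) _; rewrite mulrC; lra.
have defL := cayley_perturbation uKT TR RT ET DK EDL.
have RH := resolvent_herm KH Th uTK TR RT.
have SH := resolvent_herm KhH Th uTKh TS ST.
pose Dl := rdiag n ad.
pose N := S *m Dl *m S + S *m Dl *m R0 *m Dl *m S.
(* The resolvent of the full [K] exceeds that of [Kh] by [N], a nonnegative form. *)
have defR : R0 = S + N.
  rewrite defK in TR RT.
  exact: (resolvent_comparison (mulVmx uTKh) (mulmxV uKhT) TS ST TR RT).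
have N0 w : 0 <= qform N w.
  apply: (@qform_resolvent _ _ Dl S R0 ad) => // j jn; rewrite /ad; case: ifP => _.
    by rewrite mulr0 lexx ler01.
  split; first exact/ltW/a0.
  have := aK _ jn => aKj.
  apply: (@le_trans _ _ (2 * e * nrm K)); last by lra.
  apply: le_trans (_ : nrm R0 * nrm K <= _); first by rewrite ler_wpM2l // nrm_ge0.
  by rewrite ler_wpM2r.
pose t := V ^t* *m T *m V; pose s := V ^t* *m S *m V.
(* As [Kh] is [V K1 V ^t*], the compression of its resolvent is the resolvent of the m x m pair
   [K1], [t]. This is the purpose of cutting [K] down to [Kh]. *)
have ts : (1%:M - t *m K1) *m s = t.
  have tE : V ^t* *m ((1%:M - T *m Kh) *m S) *m V = t by rewrite TS.
  rewrite -[RHS]tE.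
  rewrite [(1%:M - T *m Kh) *m S]mulmxBl mul1mx [V ^t* *m (_ - _)]mulmxBr.
  rewrite [RHS]mulmxBl [LHS]mulmxBl mul1mx; congr (_ - _).
  by rewrite /t /s -defKh !mulmxA.
have st : s *m (1%:M - K1 *m t) = t.
  have tE : V ^t* *m (S *m (1%:M - Kh *m T)) *m V = t by rewrite ST.
  rewrite -[RHS]tE.
  rewrite [S *m (1%:M - Kh *m T)]mulmxBr mulmx1 [V ^t* *m (_ - _)]mulmxBr.
  rewrite [RHS]mulmxBl [LHS]mulmxBr mulmx1; congr (_ - _).
  by rewrite /t /s -defKh !mulmxA.
(* [M] is the compressed update without [N], so its eigenvalues [b] lie below the first m of the
   full update. *)
pose M := K1 + (1%:M - iZ K1) *m s *m (1%:M + iZ K1).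
have sH : s ^t* = s by rewrite /s !adjM trmxCK SH mulmxA.
have MH : M ^t* = M by apply: adj_cayley_form.
have [Q [b [Qu sb defM]]] := hermitian_diagonalization MH.
have le_b i : (i < m)%N -> b i <= al i.
  apply: (eigenvalue_compression lemn Yu Qu VV sal sb) => w.
  by rewrite -defM defL defR; apply: qform_cayley_le.
have u1 := @unitarymx1 R m.
have sa1 : nonincr m a by move=> i j ij jm; apply: sa => //; apply: leq_trans lemn.
have nV : nrm (V ^t*) = nrm V by apply: nrm_adj.
have close_b i : (i < m)%N -> `|b i - a i| <= g * e.
  move=> im; apply: le_trans (eigenvalue_dist u1 Qu sa1 sb im) _.
  rewrite -defM -K1d /M addrC addKr.
  apply: le_trans (nrmM _ _) _.
  have -> : g * e = nrm (1%:M - iZ K1) * (nrm V * (2 * e) * nrm V) * nrm (1%:M + iZ K1).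
    by rewrite /g; ring.
  rewrite ler_wpM2r ?nrm_ge0 //; apply: le_trans (nrmM _ _) _.
  rewrite ler_wpM2l ?nrm_ge0 //; apply: le_trans (nrmM _ _) _.
  rewrite ler_wpM2r ?nrm_ge0 //; apply: le_trans (nrmM _ _) _.
  by rewrite nV ler_wpM2l ?nrm_ge0.
have close_tau i : (i < m)%N -> `|tau i - 0| <= v * e.
  move=> im; rewrite subr0; apply: le_trans (eigenvalue_small Zu stau im) _.
  rewrite -deft; apply: le_trans (nrmM _ _) _; rewrite /v mulrAC.
  rewrite ler_wpM2r ?nrm_ge0 //; apply: le_trans (nrmM _ _) _.
  by rewrite nV.
have sumb := sum_atan_le close_b.
have sumtau := sum_atan_le (e := fun=> 0) close_tau.
have phase := cayley_add_phase (fun j jm => a0 j (leq_trans jm lemn)) Qu Zu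
  K1r deft defM ts st (erefl M).
have sum0 : \sum_(i < m) atan ((fun=> 0 : R) i) = 0.
  by rewrite big1 // => i _; rewrite atan0.
rewrite sum0 subr0 in sumtau.
have -> : \sum_(i < m) atan (a i) + \sum_(i < m) atan (tau i) =
    \sum_(i < m) atan (b i).
  apply/esym/eqP; rewrite -subr_eq0; apply/eqP.
  set sb0 := \sum_(i < m) atan (b i) in sumb phase *.
  set sa0 := \sum_(i < m) atan (a i) in sumb phase *.
  set st0 := \sum_(i < m) atan (tau i) in sumtau phase *.
  (* The two angles agree modulo 2 pi, and the choice of the constant bounds their difference by
     2. *)
  suff : 2 * (sb0 - (sa0 + st0)) = 0 by move=> h; lra.
  apply: cis_eq1.
    have : `|sb0 - (sa0 + st0)| <= m%:R * (g + v) * e.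
      have := ler_normB (sb0 - sa0) st0; rewrite opprD addrA => h.
      have -> : m%:R * (g + v) * e = m%:R * (g * e) + m%:R * (v * e) by ring.
      lra.
    rewrite normrM normr_nat; have := @pi_ge2 R; lra.
  rewrite mulrBr cisD phase cisN.
  set z := cis _; have := cisD (2 * (sa0 + st0)) (- (2 * (sa0 + st0))).
  by rewrite subrr cis0 cisN.
by rewrite ler_sum // => i _; apply/le_atan/le_b.
Qed.

End CompressionBound.

(** * Order reversal and the shifted half-angle tangent *)

Section HalfAngle.
Variable R : realType.
Local Notation C := R[i].

Lemma conjU_rev n (W : 'M[C]_n) (d : nat -> C) : W \is unitarymx ->
  exists2 W' : 'M[C]_n, W' \is unitarymx &
  conjU W (cdiag n d) = conjU W' (cdiag n (fun j => d (n - j.+1)%N)).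
Proof.
move=> Wu; exists (\matrix_(i, j) W (rev_ord i) j).
  apply/unitarymxP/matrixP => i j; move/unitarymxP: Wu => /matrixP.
  move=> /(_ (rev_ord i) (rev_ord j)); rewrite !mxE (inj_eq rev_ord_inj) => <-.
  by apply: eq_bigr => k _; rewrite !mxE.
apply/matrixP => i j; rewrite /conjU !mul_mx_diag !mxE (reindex_inj rev_ord_inj).
by apply: eq_bigr => k _; rewrite !mxE.
Qed.

Lemma sum_rev m (f : nat -> R) : \sum_(i < m) f (m - i.+1)%N = \sum_(i < m) f i.
Proof. by rewrite [RHS](reindex_inj rev_ord_inj). Qed.

Lemma conjU_rdiag_opp n (W : 'M[C]_n) (d : nat -> R) : W \is unitarymx ->
  nonincr n d -> exists W' d', [/\ W' \is unitarymx, nonincr n d',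
    - conjU W (rdiag n d) = conjU W' (rdiag n d')
    & forall j, (j < n)%N -> d' j = - d (n - j.+1)%N].
Proof.
move=> Wu sd; have [W' W'u W'd] := conjU_rev (fun j => ((- d j)%:C)%C) Wu.
exists W', (fun j => - d (n - j.+1)%N); split=> //.
  move=> i j ij jn; rewrite lerN2 sd ?leq_sub2l //.
  by rewrite ltn_subrL /=; apply: leq_trans jn.
rewrite -W'd -conjUN; congr conjU; rewrite -scaleN1r cdiagZ.
by apply: eq_cdiag => j _; rewrite mulN1r rmorphN.
Qed.

(* The angle s/2 + pi/4 maps ]-pi/2, pi/2[ to ]0, pi/2[, so that this
   tangent is positive. *)
Definition htan (s : R) := tan (s / 2 + pi / 4).

Lemma htan_range (s : R) : `|s| < pi / 2 -> 0 < s / 2 + pi / 4 < pi / 2.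
Proof. by rewrite ltr_norml; lra. Qed.

Lemma atan_htan (s : R) : `|s| < pi / 2 -> atan (htan s) = s / 2 + pi / 4.
Proof.
move=> /htan_range h; apply: tanK; rewrite in_itv /=; have := @pi_gt0 R; lra.
Qed.

Lemma cos_htan (s : R) : `|s| < pi / 2 -> 0 < cos (s / 2 + pi / 4).
Proof. move=> /htan_range h; apply: cos_gt0_pihalf; have := @pi_gt0 R; lra. Qed.

Lemma htan_gt0 (s : R) : `|s| < pi / 2 -> 0 < htan s.
Proof.
move=> h; rewrite divr_gt0 ?cos_htan // sin_gt0_pihalf //; exact: htan_range.
Qed.

Lemma htan_le (s r : R) : `|s| < pi / 2 -> `|r| < pi / 2 -> s <= r -> htan s <= htan r.
Proof.
move=> sp rp; rewrite le_eqVlt => /orP[/eqP -> //|sr]; apply/ltW.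
have := htan_range sp; have := htan_range rp; have := @pi_gt0 R => p0 h1 h2.
by rewrite /htan ltr_tan ?in_itv /=; lra.
Qed.

Lemma cis_htan (s : R) : `|s| < pi / 2 ->
  1 + 'i * (htan s)%:C%C = (1 - 'i * (htan s)%:C%C) * cis (s + pi / 2) :> C.
Proof.
move=> sp; have -> : s + pi / 2 = (s / 2 + pi / 4) + (s / 2 + pi / 4) by field.
by apply: cis_tan; rewrite gt_eqF // cos_htan.
Qed.

Lemma cis_pihalf : cis (pi / 2) = 'i :> C.
Proof. by rewrite /cis cos_pihalf sin_pihalf. Qed.

Lemma small_half_tan n (lam : nat -> R) (e : R) : 0 < e ->
  exists2 d, 0 < d & forall h, `|h| < d -> forall j, (j < n)%N ->
    cos (h * lam j / 2) != 0 /\ `|tan (h * lam j / 2)| <= e.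
Proof.
move=> e0; have c0 : cos (0 : R) != 0 by rewrite cos0 oner_neq0.
have ct : tan x @[x --> (0 : R)] --> tan (0 : R) by exact: continuous_tan c0.
move: ct; rewrite tan0 => /cvgrPdist_le/(_ e e0)[/= r r0 tanr].
pose L := 1 + \sum_(j < n) `|lam j|.
have L0 : 0 < L by rewrite ltr_pwDl // sumr_ge0.
(* [r] comes from the continuity of tan at 0, and 1 <= pi/2 keeps the cosine positive. The summand 1
   in [L] allows the division even when all [lam j] vanish. *)
exists (Num.min r 1 / L).
  by rewrite divr_gt0 // lt_min r0 ltr01.
move=> h hd j jn.
have lamL : `|lam j| <= L.
  rewrite /L (bigD1 (Ordinal jn)) //= addrCA lerDl addr_ge0 // sumr_ge0 //.
have hL : `|h * lam j / 2| < Num.min r 1.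
  rewrite normrM (ger0_norm (_ : 0 <= 2^-1)) // normrM.
  rewrite ltr_pdivlMr // in hd.
  have : `|h| * `|lam j| <= `|h| * L by rewrite ler_wpM2l.
  have : 0 <= `|h| * `|lam j| by rewrite mulr_ge0.
  lra.
move: hL; rewrite lt_min => /andP[hr h1]; split.
  rewrite gt_eqF // cos_gt0_pihalf //; move: h1; rewrite ltr_norml.
  have := @pihalf_ge1 R; lra.
have := tanr (h * lam j / 2); rewrite /ball_ /= !sub0r !normrN; exact.
Qed.

End HalfAngle.

(** * Convexity from a local midpoint inequality and continuity *)

Section LocalMidpointConvexity.
Variable R : realType.

(* Maximum principle for F - chord + e (z - x) (z - y). *)
Lemma convex_of_local_midpoint (F : R -> R) (t0 : R) :
  (forall t e, 0 <= t <= t0 -> 0 < e -> exists2 d, 0 < d &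
    forall h, `|h| < d -> 0 <= t + h <= t0 -> `|F (t + h) - F t| <= e) ->
  (forall t, 0 <= t <= t0 -> exists2 d, 0 < d &
    forall h, `|h| < d -> 0 <= t + h <= t0 -> 0 <= t - h <= t0 ->
      2 * F t <= F (t + h) + F (t - h)) ->
  forall x y z, 0 <= x -> x < y -> y <= t0 -> x <= z <= y ->
    (y - x) * F z <= (y - z) * F x + (z - x) * F y.
Proof.
move=> Fc Fm x y z x0 xy yt zxy; rewrite leNgt; apply/negP => lt_z.
pose q (t : R) := (t - x) * (t - y).
pose g (t : R) := (y - x) * F t - (y - t) * F x - (t - x) * F y.
have gz : 0 < g z by rewrite /g; lra.
(* [q] is at most 0 between [x] and [y], so [e] is taken small enough to cost at most half of [g z];
   the added 1 avoids a division by 0. *)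
have [e e0 ez] : exists2 e, 0 < e & 0 < g z + e * q z.
  exists (g z / (2 * (1 + `|q z|))).
    by rewrite divr_gt0 // mulr_gt0 // ltr_pwDl.
  have : - `|q z| <= q z by rewrite lerNl -normrN ler_norm.
  set w := `|q z| => qw; have w0 : 0 <= w by apply: normr_ge0.
  have e1 : 0 <= g z / (2 * (1 + w)) by rewrite divr_ge0 ?(ltW gz) // mulr_ge0 // addr_ge0.
  have : g z / (2 * (1 + w)) * (- w) <= g z / (2 * (1 + w)) * q z.
    by rewrite ler_wpM2l.
  have e2 : g z / (2 * (1 + w)) * (1 + w) = g z / 2.
    by field; rewrite gt_eqF // ltr_pwDl.
  move: e2 e1; set k := g z / _ => e2 e1 e3; lra.
pose G t := g t + e * q t.
have cG : {within `[x, y], continuous G}.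
  apply/subspace_continuousP => t; rewrite /= in_itv /= => txy.
  have cp : {for t, continuous (fun t : R => (- ((y - t) * F x) - (t - x) * F y + e * q t))}.
    apply: continuousD; [apply: continuousB|].
    - apply: continuousN; apply: continuousM; last exact: cst_continuous.
      by apply: continuousB; [exact: cst_continuous|].
    - apply: continuousM; last exact: cst_continuous.
      by apply: continuousB; last exact: cst_continuous.
    - apply: continuousM; first exact: cst_continuous.
      by apply: continuousM; apply: continuousB => //; exact: cst_continuous.
  have -> : G = fun t => (y - x) * F t + (- ((y - t) * F x) - (t - x) * F y + e * q t).
    by apply/funext => r; rewrite /G /g; ring.
  apply: cvgD; last exact: cvg_within_filter cp.
  apply: cvgMr; apply/cvgrPdist_le => eps eps0.
  have [|d d0 Fd] := Fc t eps _ eps0; first lra.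
  rewrite near_withinE; exists d => //= r; rewrite /ball_ /= => rd; rewrite in_itv /= => rxy.
  have := Fd (r - t); rewrite [t + (r - t)]addrC subrK [`|r - t|]distrC.
  by rewrite [`|F r - F t|]distrC; apply => //; lra.
have [c cxy Gc] := EVT_max (ltW xy) cG.
move: (cxy); rewrite in_itv /= => cI.
have Gc0 : 0 < G c.
  by apply: lt_le_trans ez _; apply: Gc; rewrite in_itv.
have Gx : G x = 0 by rewrite /G /g /q; ring.
have Gy : G y = 0 by rewrite /G /g /q; ring.
have cx : x < c.
  rewrite lt_neqAle; case/andP: cI => -> _; rewrite andbT; apply/eqP => xc.
  by rewrite -xc Gx ltxx in Gc0.
have cy : c < y.
  rewrite lt_neqAle; case/andP: cI => _ ->; rewrite andbT; apply/eqP => xc.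
  by rewrite xc Gy ltxx in Gc0.
have [|d d0 Fd] := Fm c; first lra.
(* Both [c + h] and [c - h] stay in [[x, y]], where [G] is at most [G c]. *)
pose h := Num.min (d / 2) (Num.min (c - x) (y - c)).
have h0 : 0 < h by rewrite !lt_min; apply/and3P; split; lra.
have hd : h <= d / 2 by rewrite ge_min lexx.
have hx : h <= c - x by rewrite ge_min ge_min lexx orbT.
have hy : h <= y - c by rewrite ge_min ge_min lexx !orbT.
have /Fd : `|h| < d by rewrite ger0_norm; lra.
have c1 : 0 <= c + h <= t0 by lra.
have c2 : 0 <= c - h <= t0 by lra.
move=> /(_ c1 c2) mid.
have G1 : G (c + h) <= G c by apply: Gc; rewrite in_itv /=; lra.
have G2 : G (c - h) <= G c by apply: Gc; rewrite in_itv /=; lra.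
(* The chord is affine and drops out of the second difference, whereas [q] contributes [2 h^2]: this
   strict gain contradicts the maximum. *)
have eqG : G (c + h) + G (c - h) - 2 * G c =
    (y - x) * (F (c + h) + F (c - h) - 2 * F c) + 2 * e * h ^+ 2.
  by rewrite /G /g /q; ring.
have : 0 <= (y - x) * (F (c + h) + F (c - h) - 2 * F c).
  by rewrite mulr_ge0 //; lra.
have : 0 < 2 * e * h ^+ 2 by rewrite mulr_gt0 ?exprn_gt0 // mulr_gt0.
lra.
Qed.

End LocalMidpointConvexity.

(** * Convexity of the sums of the largest phases *)

Section Evolution.
Variable R : realType.
Local Notation C := R[i].

(** This is exp(ihx) for [x = conjU X (rdiag n lam)]. *)
Definition evolution n (X : 'M[C]_n) (lam : nat -> R) (h : R) : 'M[C]_n :=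
  conjU X (cdiag n (fun j => cis (h * lam j))).

(** The bound pi/2 is the form taken by the hypothesis on the norm: |e^{is} - 1| < sqrt 2 means cos
    s > 0. *)
Definition has_phases n (u : 'M[C]_n) (s : nat -> R) :=
  [/\ nonincr n s, forall j, (j < n)%N -> `|s j| < pi / 2 &
    exists2 W, W \is unitarymx & u = conjU W (cdiag n (fun j => cis (s j)))].

Lemma cayley_diag n (Y : 'M[C]_n) (d phi : nat -> R) : Y \is unitarymx ->
  (forall j, (j < n)%N ->
     1 + 'i * (d j)%:C%C = (1 - 'i * (d j)%:C%C) * cis (phi j) :> C) ->
  conjU Y (cdiag n (fun j => cis (phi j))) *m (1%:M - iZ (conjU Y (rdiag n d))) =
  1%:M + iZ (conjU Y (rdiag n d)).
Proof.
move=> Yu dphi; apply: etrans (congr1 (mulmx _) (one_sub_iZ_conjU d Yu)) _.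
apply: etrans (conjUM _ _ Yu) _; apply: etrans (esym (one_add_iZ_conjU d Yu)).
by rewrite cdiagM; congr conjU; apply: eq_cdiag => j jn; rewrite dphi // mulrC.
Qed.

Lemma nrm_conjU_rdiag_le n (P : 'M[C]_n) (d : nat -> R) (e : R) :
  (forall j, (j < n)%N -> `|d j| <= e) ->
  nrm (conjU P (rdiag n d)) <= nrm P * nrm P * n%:R * e.
Proof.
move=> de; have nd : nrm (rdiag n d) <= n%:R * e.
  rewrite mulr_natl -[X in _ *+ X]card_ord -sumr_const ler_sum // => i _.
  rewrite (bigD1 i) //= big1 ?addr0 => [|j ji].
    by rewrite !mxE eqxx mulr1n /= expr0n addr0 sqrtr_sqr de.
  by rewrite !mxE eq_sym (negbTE ji) mulr0n Normc.normc0.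
apply: le_trans (nrmM _ _) _; rewrite mulrC -!mulrA ler_wpM2l ?nrm_ge0 //.
apply: le_trans (nrmM _ _) _; rewrite nrm_adj ler_wpM2l ?nrm_ge0 //.
Qed.

Lemma small_generator n (P : 'M[C]_n) (lam : nat -> R) (e : R) : 0 < e ->
  exists2 d, 0 < d & forall h, `|h| < d ->
    (forall j, (j < n)%N -> cos (h * lam j / 2) != 0) /\
    nrm (conjU P (rdiag n (fun j => tan (h * lam j / 2)))) <= e.
Proof.
move=> e0; pose c := nrm P * nrm P * n%:R.
have c0 : 0 <= c by rewrite !mulr_ge0 ?nrm_ge0.
have c1 : 0 < 1 + c by rewrite ltr_pwDl.
have [d d0 H] := @small_half_tan R n lam (e / (1 + c)) (divr_gt0 e0 c1).
exists d => // h hd; split; first by move=> j jn; case: (H h hd j jn).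
have le_c : nrm (conjU P (rdiag n (fun j => tan (h * lam j / 2)))) <= c * (e / (1 + c)).
  by apply: nrm_conjU_rdiag_le => j jn; case: (H h hd j jn).
apply: le_trans le_c _; rewrite mulrA ler_pdivrMr // mulrC ler_wpM2l ?(ltW e0) //.
by rewrite lerDr.
Qed.

Lemma cis_half_tan (x : R) : cos (x / 2) != 0 ->
  1 + 'i * (tan (x / 2))%:C%C = (1 - 'i * (tan (x / 2))%:C%C) * cis x :> C.
Proof. by move=> c0; rewrite [in cis x](splitr x) cis_tan. Qed.

(** The scalar i commutes with everything, so it shifts the phases of [u] and of [A u] alike by
    pi/2; conjugation by [W ^t*] then makes [u] diagonal. *)
Lemma phases_cayley n (W A u : 'M[C]_n) (s s' : nat -> R) :
  W \is unitarymx -> u = conjU W (cdiag n (fun j => cis (s j))) ->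
  has_phases (A *m u) s' ->
  exists2 Y, Y \is unitarymx &
    conjU (W ^t*) A *m cdiag n (fun j => cis (s j + pi / 2)) *m
      (1%:M - iZ (conjU Y (rdiag n (fun j => htan (s' j))))) =
    1%:M + iZ (conjU Y (rdiag n (fun j => htan (s' j)))).
Proof.
move=> Wu defu [_ s'pi [W' W'u defAu]].
have W'Wu := mul_unitarymx W'u (adj_unitarymx Wu).
exists (W' *m W ^t*) => //.
have shift d : cdiag n (fun j => cis (d j + pi / 2)) =
    'i *: cdiag n (fun j => cis (d j)) :> 'M[C]_n.
  by rewrite cdiagZ; apply: eq_cdiag => j _; rewrite cisD cis_pihalf mulrC.
have -> : conjU (W ^t*) A *m cdiag n (fun j => cis (s j + pi / 2)) =
    conjU (W' *m W ^t*) (cdiag n (fun j => cis (s' j + pi / 2))).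
  rewrite !shift conjUZ -conjU_comp -defAu -scalemxAr; congr (_ *: _).
  by rewrite -conjUM ?adj_unitarymx // defu conjUK.
by apply: cayley_diag => // j jn; apply/cis_htan/s'pi.
Qed.

Lemma sum_phases n m (s : nat -> R) : (m <= n)%N ->
  (forall j, (j < n)%N -> `|s j| < pi / 2) ->
  \sum_(i < m) s i = 2 * \sum_(i < m) atan (htan (s i)) - m%:R * (pi / 2).
Proof.
move=> lemn spi.
have -> : m%:R * (pi / 2) = \sum_(i < m) (pi / 2) :> R.
  by rewrite sumr_const card_ord mulr_natl.
rewrite mulr_sumr -sumrB.
apply: eq_bigr => i _; rewrite atan_htan ?spi //; last exact: leq_trans lemn.
by field.
Qed.

(** Both hypotheses of [convex_of_local_midpoint] are local at [t], so they are checked in an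
    eigenbasis of [u t], where the path is a unitary near 1 times a diagonal matrix. *)
Lemma top_phase_sum_convex n m (X : 'M[C]_n) (lam : nat -> R)
    (u : R -> 'M[C]_n) (s : R -> nat -> R) (t0 : R) :
  (m <= n)%N -> X \is unitarymx ->
  (forall t h, 0 <= t <= t0 -> 0 <= t + h <= t0 ->
     u (t + h) = evolution X lam h *m u t) ->
  (forall t, 0 <= t <= t0 -> has_phases (u t) (s t)) ->
  forall x y z, 0 <= x -> x < y -> y <= t0 -> x <= z <= y ->
  (y - x) * (\sum_(i < m) s z i) <=
    (y - z) * (\sum_(i < m) s x i) + (z - x) * (\sum_(i < m) s y i).
Proof.
move=> lemn Xu ustep uphases.
pose al t j := htan (s t j).
have al_nonincr t : 0 <= t <= t0 -> nonincr n (al t).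
  move=> /uphases[snon spi _] i j ij jn; apply: htan_le; [exact: spi| |exact: snon].
  by apply: spi; apply: leq_ltn_trans jn.
have sumE t : 0 <= t <= t0 ->
    \sum_(i < m) s t i = 2 * \sum_(i < m) atan (al t i) - m%:R * (pi / 2).
  by move=> /uphases[_ spi _]; apply: sum_phases lemn spi.
(* [D] is i u(t) and [P] diagonalizes [x], both read in an eigenbasis of [u t]. *)
have step t : 0 <= t <= t0 -> exists (P D : 'M[C]_n),
    [/\ P \is unitarymx, D *m (1%:M - iZ (rdiag n (al t))) = 1%:M + iZ (rdiag n (al t)) &
     forall h, 0 <= t + h <= t0 -> exists2 Y, Y \is unitarymx &
      conjU P (cdiag n (fun j => cis (h * lam j))) *m D *m
        (1%:M - iZ (conjU Y (rdiag n (al (t + h))))) =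
      1%:M + iZ (conjU Y (rdiag n (al (t + h))))].
  move=> tI; have [_ spi [W Wu defu]] := uphases t tI.
  exists (X *m W ^t*), (cdiag n (fun j => cis (s t j + pi / 2))); split.
  - exact: mul_unitarymx Xu (adj_unitarymx Wu).
  - have u1 := @unitarymx1 R n.
    have c1 (B : 'M[C]_n) : conjU 1%:M B = B by rewrite /conjU adj1 mul1mx mulmx1.
    have := @cayley_diag n 1%:M (al t) (fun j => s t j + pi / 2) u1; rewrite !c1; apply.
    by move=> j jn; apply/cis_htan/spi.
  move=> h thI; rewrite -conjU_comp; apply: (phases_cayley Wu defu).
  by rewrite -[conjU X _]/(evolution X lam h) -ustep //; apply: uphases.
have gen (P : 'M[C]_n) h : P \is unitarymx ->
    (forall j, (j < n)%N -> cos (h * lam j / 2) != 0) ->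
    conjU P (cdiag n (fun j => cis (h * lam j))) *m
      (1%:M - iZ (conjU P (rdiag n (fun j => tan (h * lam j / 2))))) =
    1%:M + iZ (conjU P (rdiag n (fun j => tan (h * lam j / 2)))).
  by move=> Pu c0; apply: cayley_diag => // j jn; apply/cis_half_tan/c0.
have genH (P : 'M[C]_n) h : let T := conjU P (rdiag n (fun j => tan (h * lam j / 2))) in
    T ^t* = T by rewrite /= adj_conjU adj_rdiag.
apply: convex_of_local_midpoint.
  move=> t e tI e0; have [P [D [Pu DK stepY]]] := step t tI.
  have [c c0 H] := cayley_continuity (al_nonincr t tI).
  (* The phases are twice the arctangents and m of them are summed, hence the factor
     [2 * (1 + m%:R)]; the minimum with 1 meets the smallness condition on [T], and [1 + c] is
     nonzero even if [c] is 0. *)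
  pose eta := Num.min 1 (e / (2 * (1 + m%:R))) / (1 + c).
  have m1 : 0 < 2 * (1 + m%:R) :> R by rewrite mulr_gt0 // ltr_pwDl.
  have c1 : 0 < 1 + c by rewrite ltr_pwDl.
  have em0 : 0 < e / (2 * (1 + m%:R)) by rewrite divr_gt0.
  have eta0 : 0 < eta by rewrite divr_gt0 // lt_min ltr01.
  have ceta : c * eta <= Num.min 1 (e / (2 * (1 + m%:R))).
    rewrite mulrA ler_pdivrMr // mulrC ler_wpM2l ?lerDr //.
    by rewrite le_min ler01 ltW.
  have [d d0 Hd] := @small_generator n P lam eta eta0.
  exists d => // h hd thI; have [cosn nT] := Hd h hd.
  have [Y Yu EDL] := stepY h thI.
  set T := conjU P (rdiag n _) in nT.
  have cT : c * nrm T <= Num.min 1 (e / (2 * (1 + m%:R))).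
    by apply: le_trans ceta; rewrite ler_wpM2l.
  have cT1 : c * nrm T <= 1 by apply: le_trans cT _; rewrite ge_min lexx.
  have cTe : c * nrm T <= e / (2 * (1 + m%:R)).
    by apply: le_trans cT _; rewrite ge_min lexx orbT.
  have dist := H T _ D Y (al (t + h)) cT1 (gen P h Pu cosn) DK Yu
    (al_nonincr _ thI) EDL.
  have := sum_atan_le (fun i im => dist i (leq_trans im lemn)).
  rewrite !sumE // => sumd.
  set A := \sum_(i < m) _ in sumd *; set B := \sum_(i < m) _ in sumd *.
  have -> : 2 * A - m%:R * (pi / 2) - (2 * B - m%:R * (pi / 2)) = 2 * (A - B) by ring.
  rewrite normrM normr_nat.
  have : m%:R * (c * nrm T) <= (1 + m%:R) * (e / (2 * (1 + m%:R))).
    by apply: ler_pM; rewrite ?lerDr // mulr_ge0 // nrm_ge0.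
  have -> : (1 + m%:R) * (e / (2 * (1 + m%:R))) = e / 2.
    by field; rewrite gt_eqF // ltr_pwDl.
  lra.
move=> t tI; have [P [D [Pu DK stepY]]] := step t tI.
have al_gt0 j : (j < n)%N -> 0 < al t j.
  by move=> jn; have [_ spi _] := uphases t tI; apply/htan_gt0/spi.
have [c c0 H] := cayley_lower_bound lemn (al_nonincr t tI) al_gt0.
have c1 : 0 < 1 + c by rewrite ltr_pwDl.
have eta0 : 0 < (1 + c)^-1 by rewrite invr_gt0.
have [d d0 Hd] := @small_generator n P lam _ eta0.
exists d => // h hd thI thI'; have [cosn nT] := Hd h hd.
have [|cosn' nT'] := Hd (- h); first by rewrite normrN.
have [Y Yu EDL] := stepY h thI; have [Y' Y'u EDL'] := stepY (- h) thI'.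
set T := conjU P (rdiag n _) in nT; set T' := conjU P (rdiag n _) in nT'.
(* The compressions of [T] and [T'] are opposite, so their eigenvalues are opposite in reversed
   order, and their sums of arctangents cancel when the two lower bounds are added. *)
have TT' : T' = - T.
  rewrite /T' /T -conjUN; congr conjU; rewrite -[RHS]scaleN1r cdiagZ; apply: eq_cdiag => j _.
  by rewrite mulN1r -rmorphN !mulNr tanN.
have cn (B : 'M[C]_n) : nrm B <= (1 + c)^-1 -> c * nrm B <= 1.
  move=> nB; apply: (@le_trans _ _ (c * (1 + c)^-1)); first by rewrite ler_wpM2l.
  by rewrite ler_pdivrMr // mul1r lerDr.
pose V := firsts R m n.
have tH : (V ^t* *m T *m V) ^t* = V ^t* *m T *m V.
  by rewrite adjM [(_ *m T) ^t*]adjM (genH P h : T ^t* = T) trmxCK mulmxA.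
have [Z [tau [Zu stau deft]]] := hermitian_diagonalization tH.
have [Z' [tau' [Z'u stau' deft' tauE]]] := conjU_rdiag_opp Zu stau.
have deft2 : V ^t* *m T' *m V = conjU Z' (rdiag m tau').
  by rewrite -deft' -deft TT' mulmxN mulNmx.
have low := H T _ D Y Z _ tau (genH P h) (cn _ nT) (gen P h Pu cosn) DK Yu
  (al_nonincr _ thI) EDL Zu stau deft.
have low' := H T' _ D Y' Z' _ tau' (genH P (- h)) (cn _ nT') (gen P (- h) Pu cosn') DK
  Y'u (al_nonincr _ thI') EDL' Z'u stau' deft2.
have sumt : \sum_(i < m) atan (tau' i) = - \sum_(i < m) atan (tau i).
  rewrite -(sum_rev m (fun i => atan (tau i))) -sumrN; apply: eq_bigr => i _.
  by rewrite tauE // atanN.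
rewrite sumt in low'; rewrite !sumE //.
move: low low'; move: (\sum_(i < m) _) (\sum_(i < m) _) (\sum_(i < m) _) (\sum_(i < m) _).
clear -R; move=> A B C0 D0; lra.
Qed.

End Evolution.

(** * The eigenvalue list of a diagonalized matrix *)

Section Eigenvalues.
Variable R : realType.
Local Notation C := R[i].

(** [eigvals] is known only through the factorization of [char_poly]; unique factorization
    determines it up to order, and sorting then removes the choice. *)
Lemma perm_eq_roots (r s : seq C) :
  \prod_(z <- r) ('X - z%:P) = \prod_(z <- s) ('X - z%:P) -> perm_eq r s.
Proof.
elim: r s => [|z r IHr] s.
  rewrite big_nil; case: s => // z s /(congr1 (fun p : {poly C} => p.[z])).
  by rewrite big_cons !hornerE subrr mul0r => /eqP; rewrite oner_eq0.
move=> rs; have zs : z \in s.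
  have := root_prod_XsubC s z; rewrite -rs big_cons /root !hornerE subrr mul0r eqxx.
  by move=> <-.
have sz := perm_to_rem zs; rewrite perm_sym (permPl sz) perm_cons perm_sym; apply: IHr.
move: rs; rewrite (perm_big _ sz) !big_cons.
by apply: mulfI; rewrite polyXsubC_eq0.
Qed.

Lemma char_poly_conjU n (W A : 'M[C]_n) : W \is unitarymx ->
  char_poly (conjU W A) = char_poly A.
Proof.
move=> Wu; rewrite /char_poly.
have WW : map_mx polyC (W ^t*) *m map_mx polyC W = 1%:M.
  by rewrite -map_mxM unitarymx_adjK // map_mx1.
have -> : char_poly_mx (conjU W A) =
    map_mx polyC (W ^t*) *m char_poly_mx A *m map_mx polyC W.
  rewrite /char_poly_mx /conjU !map_mxM mulmxBr mulmxBl; congr (_ - _).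
  by rewrite scalar_mxC -mulmxA WW mulmx1.
rewrite !det_mulmx mulrAC -det_mulmx WW det1 mul1r //.
Qed.

Lemma eigvals_conjU n (W : 'M[C]_n) (d : nat -> C) : W \is unitarymx ->
  perm_eq (eigvals (conjU W (cdiag n d))) (mkseq d n).
Proof.
move=> Wu; apply: perm_eq_roots; rewrite /eigvals; case: closed_field_poly_normal => r /=.
rewrite (monicP (char_poly_monic _)) scale1r => <-; rewrite char_poly_conjU //.
rewrite char_poly_trig; last by apply: diag_mx_is_trig.
rewrite /mkseq big_map.
have -> : iota 0 n = index_iota 0 n by rewrite /index_iota subn0.
rewrite big_mkord.
by apply: eq_bigr => i _; rewrite !mxE eqxx.
Qed.

Lemma eig_conjU n (W : 'M[C]_n) (d : nat -> R) k : W \is unitarymx ->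
  eig (conjU W (rdiag n d)) k = (sort (fun a b : R => b <= a) (mkseq d n))`_(k.-1).
Proof.
move=> Wu; rewrite /eig; congr (_`_ _); apply/perm_sortP.
- by move=> x y; apply: le_total.
- by move=> x y z yx zy; apply: le_trans zy yx.
- by move=> x y; rewrite andbC => /le_anti.
have := perm_map (@complex.Re R) (eigvals_conjU (fun j => ((d j)%:C)%C) Wu).
by rewrite /mkseq -map_comp.
Qed.

Lemma sort_nonincr n (d : nat -> R) : nonincr n d ->
  sort (fun a b : R => b <= a) (mkseq d n) = mkseq d n.
Proof.
move=> sd; apply: sorted_sort; first by move=> x y z yx zy; apply: le_trans zy yx.
apply/(sortedP 0) => i; rewrite size_mkseq => iN; rewrite !nth_mkseq ?sd //.
exact: ltnW.
Qed.

Lemma rdiag_conjU_perm n (W X : 'M[C]_n) (a b : nat -> R) :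
  W \is unitarymx -> X \is unitarymx ->
  conjU W (rdiag n a) = conjU X (rdiag n b) -> perm_eq (mkseq a n) (mkseq b n).
Proof.
move=> Wu Xu ab.
have pa := eigvals_conjU (fun j => ((a j)%:C)%C) Wu.
have pb := eigvals_conjU (fun j => ((b j)%:C)%C) Xu.
rewrite -/(rdiag n a) ab in pa.
have := perm_map (@complex.Re R) (perm_trans (etrans (perm_sym _ _) pa) pb).
by rewrite /mkseq -!map_comp.
Qed.

End Eigenvalues.

(** * The operator norm of a diagonalized matrix *)

Section OperatorNorm.
Variable R : realType.
Local Notation C := R[i].
Local Notation normc := (@Normc.normc R).

Lemma l2norm_ge0 n (v : 'cV[C]_n) : 0 <= l2norm v.
Proof. exact: sqrtr_ge0. Qed.

Lemma l2norm_sqr n (v : 'cV[C]_n) : ((l2norm v ^+ 2)%:C)%C = qform 1%:M v.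
Proof.
rewrite sqr_sqrtr ?sumr_ge0 // => [|i _]; last by rewrite sqr_ge0.
by rewrite qform1 rmorph_sum; apply: eq_bigr => i _; rewrite rmorphXn.
Qed.

Lemma l2norm_le n m (v : 'cV[C]_n) (w : 'cV[C]_m) (c : R) : 0 <= c ->
  qform 1%:M v <= ((c ^+ 2)%:C)%C * qform 1%:M w -> l2norm v <= c * l2norm w.
Proof.
move=> c0; rewrite -!l2norm_sqr -rmorphM lecR -exprMn => h.
by rewrite -(@ler_pXn2r _ 2) // nnegrE ?mulr_ge0 ?l2norm_ge0.
Qed.

Lemma l2norm_conjU_le n (W : 'M[C]_n) (d : nat -> C) (c : R) v : W \is unitarymx ->
  0 <= c -> (forall j, (j < n)%N -> normc (d j) <= c) ->
  l2norm (conjU W (cdiag n d) *m v) <= c * l2norm v.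
Proof.
move=> Wu c0 dc; apply: l2norm_le => //.
rewrite /conjU -!mulmxA qform1_isometry; last first.
  by rewrite trmxCK (unitarymxP _).
rewrite -(qform1_isometry v (unitarymx_adjK Wu)) !qform1 mulr_sumr ler_sum // => j _.
rewrite mul_diag_mx !mxE normrM exprMn ler_wpM2r ?exprn_ge0 //.
have le_c : `|d j| <= (c%:C)%C by rewrite -[`|d j|]/((normc (d j))%:C%C) lecR dc.
by rewrite rmorphXn lerXn2r ?nnegrE // ler0c.
Qed.

Lemma opnorm_conjU_le n (W : 'M[C]_n) (d : nat -> C) (c : R) : W \is unitarymx ->
  0 <= c -> (forall j, (j < n)%N -> normc (d j) <= c) ->
  opnorm (conjU W (cdiag n d)) <= c.
Proof.
move=> Wu c0 dc; apply: ge_sup.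
  exists (l2norm (conjU W (cdiag n d) *m 0)); exists 0 => //=.
  by rewrite /l2norm big1 ?sqrtr0 ?ler01 // => i _; rewrite mxE Normc.normc0 expr0n.
move=> _ [v /= v1 <-]; apply: le_trans (l2norm_conjU_le v Wu c0 dc) _.
by rewrite ler_piMr.
Qed.

Lemma opnorm_conjU_ge n (W : 'M[C]_n) (d : nat -> C) j : W \is unitarymx ->
  (j < n)%N -> normc (d j) <= opnorm (conjU W (cdiag n d)).
Proof.
(* [sup] is an upper bound only when the set is bounded, which [c] provides; the value itself is
   attained at the eigenvector [W ^t* e]. *)
move=> Wu jn; pose c := \sum_(k < n) normc (d k).
have c0 : 0 <= c by rewrite sumr_ge0 // => k _; apply: normc_ge0.
have dc k : (k < n)%N -> normc (d k) <= c.
  move=> kn; rewrite /c (bigD1 (Ordinal kn)) //= lerDl sumr_ge0 // => l _.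
  exact: normc_ge0.
apply: ub_le_sup.
  exists c => _ [v /= v1 <-]; apply: le_trans (l2norm_conjU_le v Wu c0 dc) _.
  by rewrite ler_piMr.
pose e : 'cV[C]_n := delta_mx (Ordinal jn) 0.
have e1 : qform 1%:M e = 1.
  rewrite qform1 (bigD1 (Ordinal jn)) //= big1 => [|k kj]; last first.
    by rewrite mxE (negbTE kj) normr0 expr0n.
  by rewrite mxE !eqxx normr1 expr1n addr0.
have WW : (W ^t*) ^t* *m W ^t* = 1%:M by rewrite trmxCK (unitarymxP _).
have sqr_eq1 (v : 'cV[C]_n) (r : R) : 0 <= r -> qform 1%:M v = ((r ^+ 2)%:C)%C -> l2norm v = r.
  move=> r0; rewrite -l2norm_sqr => /complexI/eqP.
  by rewrite eqrXn2 ?l2norm_ge0 // => /eqP.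
exists (W ^t* *m e).
  by rewrite /= (sqr_eq1 _ 1) // qform1_isometry // e1 expr1n.
apply: sqr_eq1; first exact: normc_ge0.
rewrite /conjU -!mulmxA (mulmxA W) (unitarymxP _) // mul1mx qform1_isometry //.
have -> : cdiag n d *m e = d j *: e.
  apply/colP => k; rewrite mul_diag_mx !mxE; case: eqP => [->|_] //.
  by rewrite !mulr0.
transitivity (`|d j| ^+ 2 * qform 1%:M e); last by rewrite e1 mulr1 rmorphXn.
by rewrite !qform1 mulr_sumr; apply: eq_bigr => i _; rewrite mxE normrM exprMn.
Qed.

End OperatorNorm.

(** * The exponential of a diagonalized skew-Hermitian matrix *)

Section Exponential.
Variable R : realType.
Local Notation C := R[i].
Local Notation normc := (@Normc.normc R).

Lemma normc_real (x : R) : normc (x%:C)%C = `|x|.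
Proof. by rewrite /= expr0n addr0 sqrtr_sqr. Qed.

Lemma normc_i : normc 'i = 1.
Proof. by rewrite -complexiE /= expr0n expr1n add0r sqrtr1. Qed.

Lemma cvg_complex (a b : R^nat) (l k : R) :
  a @ \oo --> l -> b @ \oo --> k ->
  (fun n => (a n +i* b n)%C : C) @ \oo --> ((l +i* k)%C : C).
Proof.
move=> al bk; apply/cvgrPdist_le => e e0.
have eE : e = ((complex.Re e)%:C)%C by rewrite RRe_real // gtr0_real.
have e20 : 0 < complex.Re e / 2 by move: e0; rewrite eE ltcR; lra.
move/cvgrPdist_le: al => /(_ _ e20) al; move/cvgrPdist_le: bk => /(_ _ e20) bk.
near=> n.
have an : `|l - a n| <= complex.Re e / 2 by near: n.
have bn : `|k - b n| <= complex.Re e / 2 by near: n.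
rewrite eE -[`|_|]/((normc _)%:C%C) lecR.
have -> : ((l +i* k)%C : C) - (a n +i* b n)%C = ((l - a n)%:C)%C + 'i * ((k - b n)%:C)%C.
  by apply/eqP; rewrite eq_complex /= !(mul0r, mul1r, mulr0, addr0, add0r, subr0) !eqxx.
apply: le_trans (le_normcD _ _) _; rewrite Normc.normcM !normc_real normc_i mul1r.
lra.
Unshelve. all: by end_near. Qed.

Lemma exp_coeff_cis (x : R) k :
  (k`!%:R : C)^-1 * ('i * (x%:C)%C) ^+ k = (cos_coeff x k +i* sin_coeff x k)%C.
Proof.
rewrite cos_coeffE sin_coeffE /= exprMn -rmorphXn.
have -> : (k`!%:R : C)^-1 = (((k`!%:R : R)^-1)%:C)%C.
  by rewrite fmorphV rmorph_nat.
have m1 : (-1 : C) = ((-1)%:C)%C by rewrite rmorphN1.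
have ik : 'i ^+ k = (((~~ odd k)%:R * (-1) ^+ k./2 : R) +i*
    ((odd k)%:R * (-1) ^+ k.-1./2 : R))%C :> C.
  rewrite -[in LHS](odd_double_half k); case: (boolP (odd k)) => ok /=.
    rewrite exprS -mul2n exprM sqrCi mul0r mul1r.
    have -> : k.-1./2 = k./2 by rewrite -[in LHS](odd_double_half k) ok /= doubleK.
    rewrite m1 -rmorphXn; apply/eqP; rewrite eq_complex /=.
    by rewrite !(mul0r, mul1r, mulr0, mulr1, addr0, add0r, subr0, oppr0) !eqxx.
  rewrite add0n -mul2n exprM sqrCi mul1r mul0r.
  by rewrite m1 -rmorphXn.
rewrite ik; apply/eqP; rewrite eq_complex /=.
by apply/andP; split; apply/eqP; ring.
Qed.

Lemma cvg_exp_cis (x : R) :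
  series (fun k => (k`!%:R : C)^-1 * ('i * (x%:C)%C) ^+ k) @ \oo --> cis x.
Proof.
have -> : series (fun k => (k`!%:R : C)^-1 * ('i * (x%:C)%C) ^+ k) =
    (fun n => (series (cos_coeff x) n +i* series (sin_coeff x) n)%C).
  apply/funext => n; rewrite /series /=; elim: n => [|n IHn]; first by rewrite !big_nil.
  by rewrite !big_nat_recr //= IHn exp_coeff_cis.
apply: cvg_complex.
  rewrite unlock; exact: is_cvg_series_cos_coeff.
rewrite unlock; exact: is_cvg_series_sin_coeff.
Qed.

Lemma conjUX n (W : 'M[C]_n) (d : nat -> C) k : W \is unitarymx ->
  (conjU W (cdiag n d)) ^+ k = conjU W (cdiag n (fun j => d j ^+ k)).
Proof.
move=> Wu; elim: k => [|k IHk].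
  by rewrite expr0 (_ : cdiag n _ = 1%:M) ?conjU1 // -cdiag_cst; apply: eq_cdiag.
rewrite exprS IHk; apply: etrans (conjUM _ _ Wu) _; rewrite cdiagM.
by congr conjU; apply: eq_cdiag => j _; rewrite exprS.
Qed.

(** Expansion along the spectral projections: the exponential series becomes a finite combination of
    fixed matrices with scalar series as coefficients. *)
Lemma conjU_cdiag_sum n (W : 'M[C]_n) (d : nat -> C) :
  conjU W (cdiag n d) = \sum_(j < n) d j *: conjU W (cdiag n (fun i => (i == j)%:R)).
Proof.
have -> : cdiag n d = \sum_(j < n) d j *: cdiag n (fun i => (i == j)%:R).
  apply/matrixP => i k; rewrite summxE !mxE (bigD1 i) //= !mxE eqxx big1 ?addr0.
    by case: eqP; rewrite ?mulr1n ?mulr0n ?mulr1 ?mulr0.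
  move=> l li; rewrite !mxE -val_eqE /= in li *.
  by rewrite eq_sym (negbTE li) mul0rn mulr0.
rewrite /conjU mulmx_sumr mulmx_suml; apply: eq_bigr => j _.
by rewrite -scalemxAr -scalemxAl.
Qed.

Lemma expmx_conjU n (W : 'M[C]_n) (d : nat -> R) : W \is unitarymx ->
  expmx (conjU W (cdiag n (fun j => 'i * (d j)%:C%C))) =
  conjU W (cdiag n (fun j => cis (d j))).
Proof.
move=> Wu; apply: cvg_lim; first exact: norm_hausdorff.
have -> : series (fun k : nat => (k`!%:R : C)^-1 *:
      conjU W (cdiag n (fun j => 'i * (d j)%:C%C)) ^+ k) =
    (fun N => \sum_(j < n) series (fun k => (k`!%:R : C)^-1 * ('i * ((d j)%:C)%C) ^+ k) N *:
      conjU W (cdiag n (fun i => (i == j)%:R))).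
  apply/funext => N; rewrite -(conjU_cdiag_sum W
    (fun j => series (fun k => (k`!%:R : C)^-1 * ('i * ((d j)%:C)%C) ^+ k) N)).
  rewrite /series /=; elim: N => [|N IHN].
    rewrite big_geq // (eq_cdiag (e := fun=> 0)) => [|j _]; last by rewrite big_geq.
    by rewrite cdiag_cst raddf0 /conjU mulmx0 mul0mx.
  rewrite big_nat_recr //= IHN (conjUX (fun j => 'i * (d j)%:C%C) N Wu) -conjUZ cdiagZ
    -conjUD cdiagD.
  by congr conjU; apply: eq_cdiag => j _; rewrite big_nat_recr.
rewrite conjU_cdiag_sum; apply: cvg_big => [|j _]; first exact: add_continuous.
by apply: cvgZr_tmp; apply: cvg_exp_cis.
Qed.

End Exponential.

(** * Phases from the principal logarithm, and singular values *)

Section PrincipalLogarithm.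
Variable R : realType.
Local Notation C := R[i].
Local Notation normc := (@Normc.normc R).

Lemma unitary_diagonalization n (u : 'M[C]_n) : u \is unitarymx ->
  exists W z, [/\ W \is unitarymx, u = conjU W (cdiag n z)
    & forall j, (j < n)%N -> normc (z j) = 1].
Proof.
move=> uu; have un : u \is normalmx.
  by apply/normalmxP; rewrite (unitarymxP _) // unitarymx_adjK.
have /orthomx_spectralP := un; set P := spectralmx u; set D := spectral_diag u => defu.
have Pu : P \is unitarymx by apply: spectral_unitarymx.
rewrite invmx_unitary // in defu; clearbody P D.
pose z j := if insub j is Some i then D 0 i else 1.
have defD : diag_mx D = cdiag n z.
  by congr diag_mx; apply/rowP => j; rewrite mxE /z valK.
rewrite defD in defu; exists P, z; split=> // j jn.
have Pu' := adj_unitarymx Pu.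
have DE : cdiag n z = conjU (P ^t*) u.
  exact: etrans (esym (conjUK (cdiag n z) Pu)) (congr1 (conjU (P ^t*)) (esym defu)).
have : conjU (P ^t*) u *m (conjU (P ^t*) u) ^t* = 1%:M.
  rewrite adj_conjU; apply: etrans (conjUM _ _ Pu') _.
  by rewrite (unitarymxP uu) conjU1.
rewrite -DE adj_cdiag cdiagM.
move=> /matrixP/(_ (Ordinal jn) (Ordinal jn)); rewrite !mxE eqxx /= !mulr1n.
rewrite -normCK => /eqP; rewrite sqrf_eq1 => /orP[/eqP/complexI //|/eqP h].
have : 0 <= `|z j| by apply: normr_ge0.
by rewrite h oppr_ge0 ler10.
Qed.

Lemma normc_sqr (z : C) : normc z ^+ 2 = complex.Re z ^+ 2 + complex.Im z ^+ 2.
Proof. by case: z => a b /=; rewrite sqr_sqrtr // addr_ge0 // sqr_ge0. Qed.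

(** On the unit circle |z - 1|^2 = 2 - 2 Re z. *)
Lemma Re_gt0_of_near1 (z : C) : normc z = 1 -> normc (z - 1) < Num.sqrt 2 ->
  0 < complex.Re z.
Proof.
move=> z1 z2; have : normc (z - 1) ^+ 2 < 2.
  rewrite -[ltRHS](@sqr_sqrtr _ 2) // ltrXn2r // ?nnegrE ?sqrtr_ge0 //; exact: normc_ge0.
have := congr1 (fun x => x ^+ 2) z1; rewrite !normc_sqr.
case: z {z1 z2} => a b /=; rewrite oppr0 addr0 => h1 h2.
have : (a - 1) ^+ 2 + b ^+ 2 = a ^+ 2 + b ^+ 2 - 2 * a + 1 by ring.
rewrite h1; lra.
Qed.

Lemma cis_asin (z : C) : normc z = 1 -> 0 < complex.Re z ->
  `|asin (complex.Im z)| < pi / 2 /\ cis (asin (complex.Im z)) = z.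
Proof.
move=> z1; have := congr1 (fun x => x ^+ 2) z1; rewrite normc_sqr expr1n.
case: z {z1} => a b /= ab a0.
have b1 : b ^+ 2 < 1 by rewrite -ab ltrDr exprn_gt0.
have bI : -1 < b < 1.
  by rewrite -ltr_norml -(@ltr_pXn2r _ 2) ?nnegrE // expr1n real_normK ?num_real.
have bI' : -1 <= b <= 1 by lra.
split.
  by rewrite ltr_norml asin_gtNpi2 ?asin_ltpi2 //; lra.
rewrite /cis cos_asin // asinK ?in_itv //=.
have -> : 1 - b ^+ 2 = a ^+ 2 by rewrite -ab addrK.
by rewrite sqrtr_sqr ger0_norm // ltW.
Qed.

(** The definition of the logarithm only gives |x| < pi; the bound sqrt 2, through the sign of the
    cosine, improves it. *)
Lemma abs_lt_pihalf (x : R) : `|x| < pi -> 0 < cos x -> `|x| < pi / 2.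
Proof.
move=> xpi cx; rewrite ltNge; apply/negP => pix.
have : cos `|x| <= cos (pi / 2).
  move: pix; rewrite le_eqVlt => /orP[/eqP <- //|pix]; apply/ltW.
  rewrite ltr_cos // in_itv /=; have := @pi_gt0 R; lra.
by rewrite cos_pihalf cos_norm leNgt cx.
Qed.

Lemma unitary_sub1 n (W : 'M[C]_n) (z : nat -> C) : W \is unitarymx ->
  conjU W (cdiag n z) - 1%:M = conjU W (cdiag n (fun j => z j - 1)).
Proof.
move=> Wu; rewrite -[X in _ - X](conjU1 Wu) -conjUN -conjUD; congr conjU.
by rewrite -cdiag_cst -[X in _ + X]scaleN1r cdiagZ cdiagD; apply: eq_cdiag => j _; rewrite mulN1r.
Qed.

Lemma iZ_mulNi n (A : 'M[C]_n) : - 'i *: ('i *: A) = A.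
Proof. by rewrite scalerA mulNr -expr2 sqrCi opprK scale1r. Qed.

Lemma mulNi_iZ n (A : 'M[C]_n) : 'i *: (- 'i *: A) = A.
Proof. by rewrite scalerA mulrN -expr2 sqrCi opprK scale1r. Qed.

(** [logmx] is a choice with default value 0, so a logarithm is first built from the arcsines of the
    imaginary parts of the eigenvalues. *)
Lemma logmx_phases n (u : 'M[C]_n) : u \is unitarymx ->
  opnorm (u - 1%:M) < Num.sqrt 2 ->
  exists s W, [/\ has_phases u s, W \is unitarymx & - 'i *: logmx u = conjU W (rdiag n s)].
Proof.
move=> uu un; have : exists L : 'M[C]_n, [/\ - 'i *: L \is hermsymmx, expmx L = u
    & opnorm (- 'i *: L) < pi].
  have [W [z [Wu defu z1]]] := unitary_diagonalization uu.
  have zP j : (j < n)%N -> `|asin (complex.Im (z j))| < pi / 2 /\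
      cis (asin (complex.Im (z j))) = z j.
    move=> jn; apply: cis_asin; first exact: z1.
    apply: Re_gt0_of_near1; first exact: z1.
    apply: le_lt_trans un; rewrite defu unitary_sub1 //.
    exact: (opnorm_conjU_ge (fun j => z j - 1)).
  pose d j := asin (complex.Im (z j)).
  exists ('i *: conjU W (rdiag n d)); rewrite iZ_mulNi; split.
  - by apply/hermsymmxP; rewrite adj_conjU adj_rdiag.
  - rewrite -[_ *: _]/(iZ _) iZ_conjU expmx_conjU // defu; congr conjU.
    by apply: eq_cdiag => j jn; have [_ ->] := zP j jn.
  - apply: (@le_lt_trans _ _ (pi / 2)); last by have := @pi_gt0 R; lra.
    apply: opnorm_conjU_le => //; first by have := @pi_gt0 R; lra.
    by move=> j jn; rewrite normc_real; apply/ltW; have [] := zP j jn.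
(* From here the chosen [L] is known only by its three defining properties, and it is diagonalized
   afresh. *)
move=> /(@xgetPex _ 0) -[]; rewrite -/(logmx u).
move: (logmx u) => L /hermsymmxP Lh Lu Ln.
have [W [s [Wu ss defL]]] := hermitian_diagonalization Lh.
have defu : u = conjU W (cdiag n (fun j => cis (s j))).
  have LE : L = conjU W (cdiag n (fun j => 'i * (s j)%:C%C)).
    apply: etrans (esym (mulNi_iZ L)) _.
    by apply: etrans (congr1 (fun X => 'i *: X) defL) _; apply: iZ_conjU.
  by apply: etrans (esym Lu) _; rewrite LE; apply: expmx_conjU.
exists s, W; split=> //; split=> // [j jn|]; last by exists W.
apply: abs_lt_pihalf.
  apply: le_lt_trans Ln; rewrite defL -normc_real.
  exact: (opnorm_conjU_ge (fun j => ((s j)%:C)%C)).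
have cis1 : normc (cis (s j)) = 1 by rewrite /= cos2Dsin2 sqrtr1.
apply: (Re_gt0_of_near1 cis1); apply: le_lt_trans un; rewrite defu unitary_sub1 //.
exact: (opnorm_conjU_ge (fun j => cis (s j) - 1)).
Qed.

(** An explicit square root shows that the chosen one meets its specification. Its eigenvalues are
    nonnegative and their squares are the s_j^2 up to order. *)
Lemma singval_conjU n (W : 'M[C]_n) (s : nat -> R) k : W \is unitarymx ->
  singval (conjU W (rdiag n s)) k =
  (sort (fun a b : R => b <= a) (mkseq (fun j => `|s j|) n))`_(k.-1).
Proof.
move=> Wu; rewrite /singval /absmx.
have sqrE (X : 'M[C]_n) d : X \is unitarymx ->
    conjU X (rdiag n d) *m conjU X (rdiag n d) = conjU X (rdiag n (fun j => d j ^+ 2)).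
  move=> Xu; apply: etrans (conjUM _ _ Xu) _; rewrite cdiagM; congr conjU; apply: eq_cdiag => j _.
  by rewrite -rmorphM expr2.
rewrite adj_conjU adj_rdiag sqrE //; set A := conjU W _.
have : exists B : 'M[C]_n, psdmx B /\ B *m B = A.
  exists (conjU W (rdiag n (fun j => `|s j|))); split; last first.
    by apply: etrans (sqrE _ _ Wu) _; congr conjU; apply: eq_cdiag => j _; rewrite real_normK ?num_real.
  split; first by apply/hermsymmxP; rewrite adj_conjU adj_rdiag.
  move=> v; rewrite -/(qform _ v) qform_conj qform_cdiag sumr_ge0 // => j _.
  by rewrite mulr_ge0 ?exprn_ge0 // ler0c.
move=> /(@xgetPex _ 0) -[]; rewrite -/(sqrtmx A).
move: (sqrtmx A) => B [/hermsymmxP Bh B0] BB.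
have [Q [b [Qu sb defB]]] := hermitian_diagonalization Bh.
have u1 := @unitarymx1 R n.
have b0 i : (i < n)%N -> 0 <= b i.
  (* Courant-Fischer against the zero matrix. *)
  apply: (@eigenvalue_compression R n n b (fun=> 0) Q 1%:M 1%:M) => //.
    by rewrite adj1 mulmx1.
  move=> v; rewrite mul1mx -defB; apply: le_trans (B0 v).
  by rewrite /rdiag cdiag_cst /conjU raddf0 mulmx0 mul0mx /qform mulmx0 mul0mx mxE.
rewrite defB (eig_conjU _ _ Qu); congr (_`_ _); apply/perm_sortP.
- by move=> x y; apply: le_total.
- by move=> x y z yx zy; apply: le_trans zy yx.
- by move=> x y; rewrite andbC => /le_anti.
rewrite defB (sqrE _ _ Qu) in BB; have := perm_map Num.sqrt (rdiag_conjU_perm Qu Wu BB).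
rewrite /mkseq -!map_comp => pe.
have -> : [seq b j | j <- iota 0 n] = [seq (Num.sqrt \o (fun j => b j ^+ 2)) i | i <- iota 0 n].
  apply/eq_in_map => j; rewrite mem_iota /= => jn; rewrite sqrtr_sqr ger0_norm //.
  exact: b0.
apply: perm_trans pe _; rewrite (@eq_map _ _ _ (fun j => `|s j|)) // => j.
by rewrite /= sqrtr_sqr.
Qed.

End PrincipalLogarithm.

(** * Sums of the largest absolute values as a maximum of signed sums *)

Section SumsOfLargest.
Variable R : realType.
Implicit Types d : nat -> R.

Lemma sum_top n k d : (k <= n)%N ->
  \sum_(i < n | (i < k)%N) d i = \sum_(i < k) d i.
Proof. by move=> kn; rewrite (big_ord_widen n d kn). Qed.

Lemma sum_bottom n l d : (l <= n)%N ->
  \sum_(i < n | (n - l <= i)%N) d i = \sum_(i < l) d (n - i.+1)%N.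
Proof.
move=> ln; rewrite -(sum_top (fun i => d (n - i.+1)%N) ln) (reindex_inj rev_ord_inj).
apply: eq_bigl => i /=; have := ltn_ord i => iN; apply/idP/idP => h; lia.
Qed.

Lemma sum_le_largest n d (P : pred 'I_n) : nonincr n d ->
  \sum_(i < n | P i) d i <= \sum_(i < #|P|) d i.
Proof.
move=> sd; set k := #|P|; have kn : (k <= n)%N by rewrite -[leqRHS]card_ord max_card.
have [k0|k0] := posnP k.
  rewrite k0 big_ord0 big_pred0 // => i.
  by have := card0_eq k0 i; rewrite inE.
(* Both sums have [k] terms, so the threshold [c], the least of the first [k] values, can be
   subtracted throughout; then the first [k] terms are nonnegative and the others nonpositive. *)
rewrite -(sum_top d kn) -subr_ge0; pose c := d k.-1.
have cP : \sum_(i < n | P i) c = c *+ k by rewrite sumr_const.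
have ck : \sum_(i < n | (i < k)%N) c = c *+ k.
  by rewrite (sum_top (fun=> c) kn) sumr_const card_ord.
have -> : \sum_(i < n | (i < k)%N) d i - \sum_(i < n | P i) d i =
    \sum_(i < n | (i < k)%N) (d i - c) - \sum_(i < n | P i) (d i - c).
  by rewrite !sumrB cP ck; ring.
rewrite subr_ge0 big_mkcond [leRHS]big_mkcond ler_sum // => i _.
have := ltn_ord i => iN; case: ifPn => Pi; case: ltnP => ik //.
  by rewrite subr_le0 sd //; lia.
by rewrite subr_ge0 sd //; lia.
Qed.

Lemma card_pred_inj n (f : 'I_n -> 'I_n) (P : pred 'I_n) : injective f ->
  #|[pred i | P (f i)]| = #|P|.
Proof. by move=> fI; rewrite -!sum1_card [RHS](reindex_inj fI). Qed.

Definition sorted_abs n d := sort (fun a b : R => b <= a) (mkseq (fun j => `|d j|) n).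

Lemma sorted_abs_perm n d : exists p : {perm 'I_n},
  forall i : 'I_n, (sorted_abs n d)`_i = `|d (p i)|.
Proof.
pose t := [tuple `|d j| | j < n].
have tE : val t = mkseq (fun j => `|d j|) n.
  by apply: (@eq_from_nth _ 0); rewrite size_tuple ?size_mkseq // => i iN;
    rewrite nth_mkseq // -(tnth_nth 0 t (Ordinal iN)) tnth_mktuple.
have szs : size (sorted_abs n d) == n by rewrite size_sort size_mkseq.
have /tuple_permP[p tp] : perm_eq (Tuple szs) t by rewrite tE /= perm_sort.
exists p => i; have := tnth_mktuple (fun i => tnth t (p i)) i.
by rewrite (tnth_nth 0) -tp /= => ->; rewrite tnth_mktuple.
Qed.

Lemma sorted_abs_nonincr n d : nonincr n (nth 0 (sorted_abs n d)).
Proof.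
move=> j k jk kn; have ss : sorted (fun x y : R => y <= x) (sorted_abs n d).
  by apply: sort_sorted => x y; apply: le_total.
apply: (sorted_leq_nth (leT := fun x y : R => y <= x)) => //.
- by move=> x y z yx zy; apply: le_trans zy yx.
- by rewrite inE size_sort size_mkseq (leq_ltn_trans jk).
- by rewrite inE size_sort size_mkseq.
Qed.

(** The first [k] and the last [l] indices are disjoint, so the signed sum is bounded by a sum of
    [k + l] distinct terms |d_j|. *)
Lemma sum_sorted_abs_ge n d k l : (k + l <= n)%N ->
  \sum_(i < k) d i - \sum_(i < l) d (n - i.+1)%N <=
  \sum_(i < k + l) (sorted_abs n d)`_i.
Proof.
move=> kln; have kn : (k <= n)%N by lia.
have ln : (l <= n)%N by lia.
have [p pE] := sorted_abs_perm n d.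
pose P (j : 'I_n) := (j < k)%N || (n - l <= j)%N.
have cardP : #|P| = (k + l)%N.
  apply/eqP; rewrite -(eqr_nat R) natrD; apply/eqP.
  transitivity (\sum_(i < n | P i) (1 : R)); first by rewrite sumr_const.
  transitivity (\sum_(i < n | (i < k)%N) (1 : R) + \sum_(i < n | (n - l <= i)%N) 1).
    rewrite big_mkcond [X in _ = X + _]big_mkcond [X in _ = _ + X]big_mkcond -big_split /=.
    apply: eq_bigr => i _; rewrite /P; case: ltnP => ik; case: leqP => il //=;
      rewrite ?addr0 ?add0r //; lia.
  by rewrite (sum_top (fun=> 1) kn) (sum_bottom (fun=> 1) ln) !sumr_const !card_ord.
have cardPp : #|[pred i | P (p i)]| = (k + l)%N.
  by rewrite -cardP; apply: card_pred_inj; apply: perm_inj.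
have := sum_le_largest [pred i | P (p i)] (@sorted_abs_nonincr n d).
rewrite cardPp; apply: le_trans.
have -> : \sum_(i < n | [pred i | P (p i)] i) (sorted_abs n d)`_i =
    \sum_(j < n | P j) `|d j|.
  by rewrite [RHS](reindex_inj (@perm_inj _ p)); apply: eq_bigr => i _; rewrite pE.
rewrite -(sum_top d kn) -(sum_bottom d ln) -sumrN.
rewrite big_mkcond [X in _ + X]big_mkcond [leRHS]big_mkcond -big_split ler_sum //= => i _.
have := ler_norm (d i); have := ler_norm (- d i); rewrite normrN => h1 h2.
rewrite /P; case: ltnP => ik; case: leqP => il //=; rewrite ?addr0 ?add0r //; lia.
Qed.

(** The indices of the [m] largest absolute values, selected by [Q], are split by the sign of [d]:
    [k] counts the nonnegative ones and [l] the negative ones. *)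
Lemma sum_sorted_abs_le n m d : nonincr n d -> (m <= n)%N ->
  exists k l, (k + l = m)%N /\
  \sum_(i < m) (sorted_abs n d)`_i <=
  \sum_(i < k) d i - \sum_(i < l) d (n - i.+1)%N.
Proof.
move=> sd mn; have [p pE] := sorted_abs_perm n d.
pose Q (j : 'I_n) := ((p^-1)%g j < m)%N.
pose Qp := [pred j : 'I_n | Q j && (0 <= d j)].
pose Qn := [pred j : 'I_n | Q j && (d j < 0)].
have QE (V : nmodType) (f : 'I_n -> V) :
    \sum_(j < n | Q j) f j = \sum_(i < n | (i < m)%N) f (p i).
  by rewrite (reindex_inj (@perm_inj _ p)); apply: eq_bigl => i; rewrite /Q permK.
exists #|Qp|, #|Qn|; split.
  apply/eqP; rewrite -(eqr_nat R) natrD; apply/eqP.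
  transitivity (\sum_(j < n | Qp j) (1 : R) + \sum_(j < n | Qn j) 1).
    by rewrite !sumr_const.
  transitivity (\sum_(j < n | Q j) (1 : R)).
    rewrite [RHS](bigID (fun j : 'I_n => 0 <= d j)) /=; congr (_ + _).
    by apply: eq_bigl => j; rewrite /= -ltNge.
  rewrite QE; exact: etrans (sum_top (fun=> 1) mn) (etrans (sumr_const _ _) (congr1 _ (card_ord m))).
rewrite -(sum_top (nth 0 (sorted_abs n d)) mn).
have -> : \sum_(i < n | (i < m)%N) (sorted_abs n d)`_i =
    \sum_(i < n | (i < m)%N) `|d (p i)| by apply: eq_bigr => i _; rewrite pE.
rewrite -(QE _ (fun j => `|d j|)) (bigID (fun j : 'I_n => 0 <= d j)) /= lerD //.
  apply: le_trans (sum_le_largest Qp sd); rewrite le_eqVlt; apply/orP; left; apply/eqP.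
  by apply: eq_bigr => j /andP[_ dj]; rewrite ger0_norm.
(* Negated and reversed, the smallest values of [d] become the largest of [e]. *)
pose e i := - d (n - i.+1)%N.
have se : nonincr n e by move=> i j ij jn; rewrite lerN2 sd //; lia.
rewrite -sumrN -[leRHS]/(\sum_(i < #|Qn|) e i).
have <- : #|[pred i | Qn (rev_ord i)]| = #|Qn|.
  by apply: card_pred_inj; apply: rev_ord_inj.
apply: le_trans (sum_le_largest [pred i | Qn (rev_ord i)] se).
rewrite (reindex_inj rev_ord_inj) /= le_eqVlt; apply/orP; left; apply/eqP.
apply: eq_big => [j|j /andP[_]]; first by rewrite -ltNge.
by rewrite -ltNge => dj; rewrite ltr0_norm.
Qed.

End SumsOfLargest.

(** * The chord inequality and the convexity notions of the statement *)

Section ChordConvexity.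
Variable R : realType.

Definition chord_convex (t0 : R) (F : R -> R) := forall x y z,
  0 <= x -> x < y -> y <= t0 -> x <= z <= y ->
  (y - x) * F z <= (y - z) * F x + (z - x) * F y.

Lemma chord_convexD t0 F G : chord_convex t0 F -> chord_convex t0 G ->
  chord_convex t0 (fun t => F t + G t).
Proof.
move=> cF cG x y z x0 xy yt xzy; have := cF _ _ _ x0 xy yt xzy.
by have := cG _ _ _ x0 xy yt xzy; rewrite !mulrDr; lra.
Qed.

Lemma eq_chord_convex t0 F G : (forall t, 0 <= t <= t0 -> F t = G t) ->
  chord_convex t0 F -> chord_convex t0 G.
Proof.
move=> FG cF x y z x0 xy yt xzy; rewrite -!FG; first exact: cF.
all: lra.
Qed.

(** How a maximum [S] of convex functions inherits the chord inequality: [F] is a member attaining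
    the maximum at [z], and it stays below [S] at [a] and [b]. *)
Lemma chord_le (a b z Sz Sa Sb Fz Fa Fb : R) : a <= z <= b ->
  Sz <= Fz -> Fa <= Sa -> Fb <= Sb ->
  (b - a) * Fz <= (b - z) * Fa + (z - a) * Fb ->
  (b - a) * Sz <= (b - z) * Sa + (z - a) * Sb.
Proof.
move=> azb zS aS bS F_le; have ba : 0 <= b - a by lra.
apply: le_trans (ler_wpM2l ba zS) _; apply: le_trans F_le _.
by apply: lerD; apply: ler_wpM2l => //; lra.
Qed.

Lemma chord_convexP t0 F : chord_convex t0 F ->
  forall p x y : R, 0 <= p <= 1 -> 0 <= x <= t0 -> 0 <= y <= t0 ->
  F (p * x + (1 - p) * y) <= p * F x + (1 - p) * F y.
Proof.
move=> cF; have lt_case p x y : 0 <= p <= 1 -> 0 <= x -> x < y -> y <= t0 ->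
    F (p * x + (1 - p) * y) <= p * F x + (1 - p) * F y.
  move=> pI x0 xy yt; set z := _ + _; have yx0 : 0 < y - x by lra.
  have zE : y - z = (y - x) * p by rewrite /z; ring.
  have zE' : z - x = (y - x) * (1 - p) by rewrite /z; ring.
  have xzy : x <= z <= y.
    by rewrite -subr_ge0 zE' -[z <= y]subr_ge0 zE !mulr_ge0 //; lra.
  have := cF _ _ _ x0 xy yt xzy; rewrite zE zE' -!mulrA -mulrDr.
  by rewrite ler_pM2l.
move=> p x y pI xI yI; have [xy|yx|<-] := ltgtP x y.
- by apply: lt_case => //; lra.
- have pI' : 0 <= 1 - p <= 1 by lra.
  have y0 : 0 <= y by lra.
  have xt : x <= t0 by lra.
  have := lt_case (1 - p) y x pI' y0 yx xt.
  have -> : (1 - p) * y + (1 - (1 - p)) * x = p * x + (1 - p) * y by ring.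
  by have -> : (1 - p) * F y + (1 - (1 - p)) * F x = p * F x + (1 - p) * F y by ring.
- have -> : p * x + (1 - p) * x = x by ring.
  by have -> : p * F x + (1 - p) * F x = F x by ring.
Qed.

Lemma chord_convex_function t0 (F : R -> R) : chord_convex t0 F ->
  convex_function (E := R^o) `[0, t0] F.
Proof.
move=> /chord_convexP cF p x y /set_mem + /set_mem; rewrite /= !in_itv /= => xI yI.
by apply: cF => //; rewrite ge0 le1.
Qed.

Lemma chord_concave_function t0 (F : R -> R) : chord_convex t0 (fun t => - F t) ->
  concave_function (E := R^o) `[0, t0] F.
Proof.
move=> /chord_convexP cF p x y /set_mem + /set_mem; rewrite /= !in_itv /= => xI yI.
have pI : (0 : R) <= p%:num <= 1 by rewrite ge0 le1.
have := cF p%:num x y pI xI yI; rewrite !mulrN -opprD lerN2; exact.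
Qed.

End ChordConvexity.

(** * The path u(t), its adjoint, and the phases of its logarithm *)

Section UnitaryPaths.
Variable R : realType.
Local Notation C := R[i].

Lemma expmx_evolution n (X x : 'M[C]_n) (lam : nat -> R) (t : R) : X \is unitarymx ->
  x = conjU X (rdiag n lam) ->
  expmx (('i * (t%:C)%C) *: x) = evolution X lam t.
Proof.
move=> Xu ->; rewrite -conjUZ cdiagZ.
have -> : cdiag n (fun j => 'i * t%:C%C * (lam j)%:C%C) =
    cdiag n (fun j => 'i * ((t * lam j)%:C)%C).
  by apply: eq_cdiag => j _; rewrite rmorphM mulrA.
exact: expmx_conjU.
Qed.

Lemma evolutionD n (X : 'M[C]_n) (lam : nat -> R) (s t : R) : X \is unitarymx ->
  evolution X lam (s + t) = evolution X lam s *m evolution X lam t.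
Proof.
move=> Xu; apply: etrans (esym (conjUM _ _ Xu)); rewrite cdiagM; congr conjU.
by apply: eq_cdiag => j _; rewrite mulrDl cisD.
Qed.

Lemma evolution0 n (X : 'M[C]_n) (lam : nat -> R) : X \is unitarymx ->
  evolution X lam 0 = 1%:M.
Proof.
move=> Xu; apply: etrans (conjU1 Xu); congr conjU; rewrite -cdiag_cst.
by apply: eq_cdiag => j _; rewrite mul0r cis0.
Qed.

Lemma adj_evolution n (X : 'M[C]_n) (lam : nat -> R) (t : R) :
  (evolution X lam t) ^t* = evolution X lam (- t).
Proof.
rewrite /evolution adj_conjU adj_cdiag; congr conjU; apply: eq_cdiag => j _.
by rewrite mulNr cisN.
Qed.

Lemma evolution_unitary n (X : 'M[C]_n) (lam : nat -> R) (t : R) : X \is unitarymx ->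
  evolution X lam t \is unitarymx.
Proof.
move=> Xu; apply/unitarymxP; rewrite adj_evolution -evolutionD // subrr.
exact: evolution0.
Qed.

Lemma evolutionN n (X : 'M[C]_n) (lam : nat -> R) (t : R) :
  evolution X (fun j => - lam j) t = evolution X lam (- t).
Proof. by congr conjU; apply: eq_cdiag => j _; rewrite mulrN mulNr. Qed.

Lemma eq_has_phases n (u : 'M[C]_n) (s r : nat -> R) :
  (forall j, (j < n)%N -> s j = r j) -> has_phases u s -> has_phases u r.
Proof.
move=> sr [ss spi [W Wu defu]]; split=> [i j ij jn|j jn|].
- by rewrite -!sr ?ss //; apply: leq_ltn_trans jn.
- by rewrite -sr ?spi.
by exists W => //; rewrite defu; congr conjU; apply: eq_cdiag => j jn; rewrite sr.
Qed.

Lemma has_phases_adj n (A u : 'M[C]_n) (s : nat -> R) : A \is unitarymx ->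
  has_phases u s -> has_phases (conjU A (u ^t*)) (fun j => - s (n - j.+1)%N).
Proof.
move=> Au [ss spi [W Wu ->]]; split=> [i j ij jn|j jn|].
- by rewrite lerN2 ss //; lia.
- by rewrite normrN spi //; lia.
have [W' W'u revW] := conjU_rev (fun j => cis (- s j)) Wu.
exists (W' *m A); first exact: mul_unitarymx W'u Au.
rewrite adj_conjU adj_cdiag -conjU_comp -revW; congr (conjU A (conjU W _)).
by apply: eq_cdiag => j _; rewrite cisN.
Qed.

(** [s] counts from 0 and [eig] from 1, hence [j.+1] and [k.-1]. *)
Lemma eig_logmx n (u : 'M[C]_n) (s := fun j => eig (- 'i *: logmx u) j.+1) :
  u \is unitarymx -> opnorm (u - 1%:M) < Num.sqrt 2 ->
  has_phases u s /\
  forall k, singval (- 'i *: logmx u) k = (sorted_abs n s)`_(k.-1).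
Proof.
move=> uu un; have [r [W [ph Wu defL]]] := logmx_phases uu un.
have sr j : (j < n)%N -> r j = s j.
  move=> jn; rewrite /s defL eig_conjU // sort_nonincr ?nth_mkseq //.
  by case: ph.
split; first exact: eq_has_phases sr ph.
move=> k; rewrite defL singval_conjU // /sorted_abs; congr (sort _ _)`_ _.
apply/eq_in_map => j; rewrite mem_iota => /andP[_ jn].
by rewrite sr.
Qed.

(** In u(t)^* = u(0)^* e^{-itx} the exponential stands on the right. Conjugation by e^{itx} moves it
    to the left and keeps the eigenvalues, so that [top_phase_sum_convex] applies with [- lam]. *)
Lemma bottom_phase_sum_convex n k (X : 'M[C]_n) (lam : nat -> R)
    (u : R -> 'M[C]_n) (s : R -> nat -> R) (t0 : R) : (k <= n)%N -> X \is unitarymx ->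
  0 <= t0 ->
  (forall t, u t = evolution X lam t *m u 0) ->
  (forall t, 0 <= t <= t0 -> has_phases (u t) (s t)) ->
  chord_convex t0 (fun t => - \sum_(i < k) s t (n - i.+1)%N).
Proof.
move=> kn Xu t00 ustep uphases.
pose v t := evolution X (fun j => - lam j) t *m (u 0) ^t*.
have vE t : v t = conjU (evolution X lam t) ((u t) ^t*).
  rewrite /v evolutionN -adj_evolution /conjU -mulmxA; congr (_ *m _).
  have -> : (u t) ^t* = (u 0) ^t* *m (evolution X lam t) ^t* by rewrite (ustep t) adjM.
  by rewrite -mulmxA (unitarymx_adjK (evolution_unitary lam t Xu)) mulmx1.
have := @top_phase_sum_convex R n k X (fun j => - lam j) v
  (fun t j => - s t (n - j.+1)%N) t0 kn Xu.
move=> /(_ _ _)/eq_chord_convex; apply.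
- by move=> t _; rewrite sumrN.
- by move=> t h _ _; rewrite /v addrC evolutionD // -mulmxA.
move=> t tI; rewrite vE; apply: has_phases_adj (uphases t tI).
exact: evolution_unitary.
Qed.



End UnitaryPaths.

Theorem theorem3p9 (R : realType) (n : nat) (x y : 'M[R[i]]_n) (t0 : R)
    (u := fun t : R => expmx (('i * (t%:C)%C) *: x) *m expmx ('i *: y))
    (theta := fun (k : nat) (t : R) => eig (- 'i *: logmx (u t)) k)
    (sigma := fun (k : nat) (t : R) => singval (- 'i *: logmx (u t)) k) :
  x \is hermsymmx -> y \is hermsymmx -> 0 < t0 ->
  (forall t : R, 0 <= t <= t0 -> opnorm (u t - 1%:M) < Num.sqrt 2) ->
  forall m : nat, (1 <= m <= n)%N ->
    [/\ convex_function (E := R^o) `[0, t0]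
          (fun t => \sum_(1 <= i < m.+1) theta i t),
        concave_function (E := R^o) `[0, t0]
          (fun t => \sum_(m <= i < n.+1) theta i t)
      & convex_function (E := R^o) `[0, t0]
          (fun t => \sum_(1 <= i < m.+1) sigma i t)].
Proof.
move=> xh yh t0_gt0 un m /andP[m1 mn].
have [X [lam [Xu _ defx]]] := hermitian_diagonalization (hermsymmxP _ xh).
have [Y [mu [Yu _ defy]]] := hermitian_diagonalization (hermsymmxP _ yh).
have uE t : u t = evolution X lam t *m evolution Y mu 1.
  by rewrite /u (expmx_evolution t Xu defx) -(expmx_evolution 1 Yu defy) mulr1.
clearbody u.
have uu t : u t \is unitarymx.
  rewrite uE; exact: mul_unitarymx (evolution_unitary _ _ Xu) (evolution_unitary _ _ Yu).
have ustep t : u t = evolution X lam t *m u 0.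
  apply: etrans (uE t) _; congr (_ *m _); apply/esym/(etrans (uE 0)).
  by rewrite (evolution0 _ Xu) mul1mx.
have ustepD t h : u (t + h) = evolution X lam h *m u t.
  by rewrite (ustep (t + h)) (ustep t) [t + h]addrC (evolutionD _ _ _ Xu) mulmxA.
pose s t j := theta j.+1 t.
have ph t : 0 <= t <= t0 -> has_phases (u t) (s t).
  by move=> tI; have [] := eig_logmx (uu t) (un t tI).
have sg t k : 0 <= t <= t0 -> sigma k t = (sorted_abs n (s t))`_(k.-1).
  by move=> tI; have [_] := eig_logmx (uu t) (un t tI); apply.
have top k : (k <= n)%N -> chord_convex t0 (fun t => \sum_(i < k) s t i).
  move=> kn; apply: (top_phase_sum_convex kn Xu _ ph) => t h _ _; exact: ustepD.
have bot k : (k <= n)%N -> chord_convex t0 (fun t => - \sum_(i < k) s t (n - i.+1)%N).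
  by move=> kn; apply: (bottom_phase_sum_convex kn Xu (ltW t0_gt0) ustep ph).
split.
- apply: chord_convex_function; apply: eq_chord_convex (top m mn) => t _.
  by rewrite big_add1 big_mkord.
- apply: chord_concave_function.
  (* The indices from m to n number [n - m.-1], as m >= 1. *)
  have kn : (n - m.-1 <= n)%N by apply: leq_subr.
  apply: eq_chord_convex (bot _ kn) => t _; congr (- _).
  have -> : \sum_(m <= i < n.+1) theta i t = \sum_(m.-1 <= i < n) s t i.
    by rewrite -[in LHS](prednK m1) big_add1.
  rewrite -(sum_bottom (s t) kn) subKn; last by lia.
  by rewrite big_geq_mkord.
- apply: chord_convex_function.
  pose S t := \sum_(i < m) (sorted_abs n (s t))`_i.
  apply: (@eq_chord_convex _ _ S) => [t tI|a b z a0 ab bt azb].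
    by rewrite big_add1 big_mkord; apply: eq_bigr => i _; rewrite sg.
  have [snon _ _] : has_phases (u z) (s z) by apply: ph; lra.
  (* The pair [k], [l] is chosen at the interior point [z]; the same pair gives lower bounds at both
     ends. *)
  have [k [l [klm le_z]]] := sum_sorted_abs_le snon mn.
  have kln : (k + l <= n)%N by rewrite klm.
  have kn : (k <= n)%N := leq_trans (leq_addr l k) kln.
  have ln : (l <= n)%N := leq_trans (leq_addl k l) kln.
  have le_sum := chord_convexD (top k kn) (bot l ln) a0 ab bt azb.
  have le_a := sum_sorted_abs_ge (s a) kln; have le_b := sum_sorted_abs_ge (s b) kln.
  rewrite klm in le_a le_b.
  exact: (chord_le azb le_z le_a le_b le_sum).
Qed.
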